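(* Let $r\in\mathbb N$ and let $\mathcal C$ be a hereditary class of graphs such that every graph in $\mathcal C$ is an $r$-bounded perturbation of an interval graph. Then $\mathcal C$ has bounded twin-width if and only if there is a permutation $\pi$ such that $\mathcal C$ excludes all graphs in $\mathcal R^+_\pi$.
   Context: An elementary perturbation of a graph $G$ chooses $X\subseteq V(G)$ and complements adjacency on all pairs within $X$; an $r$-bounded perturbation is the result of at most $r$ elementary perturbations. Interval graphs: intersection graphs of intervals on the line. Hereditary: closed under induced subgraphs. For a permutation $\pi$ of $\{1,\dots,p\}$, a graph $H$ exposes $\pi$ if $V(H)=W\cup W_1\cup W_2$ disjointly, $W=\{w_1,\dots,w_p\}$, $|W_1|=|W_2|=p$, each $w_i$ has nonempty neighbourhoods $N_1(w_i)$ in $W_1$ and $N_2(w_i)$ in $W_2$, $N_1(w_1)\subsetneq\dots\subsetneq N_1(w_p)$ and $N_2(w_{\pi(1)})\subsetneq\dots\subsetneq N_2(w_{\pi(p)})$ (other edges arbitrary); $\mathcal R^+_\pi$ is the set of all (non-isomorphic) graphs exposing $\pi$. ''$\mathcal C$ excludes all graphs in $\mathcal R^+_\pi$'' means no member of $\mathcal C$ is isomorphic to a member of $\mathcal R^+_\pi$. Twin-width: contracting $x_1,x_2$ in a trigraph to $x_0$ gives $N(x_0)=(N(x_1)\cup N(x_2))\setminus\{x_1,x_2\}$ and red neighbourhood $((N_r(x_1)\cup N_r(x_2))\setminus\{x_1,x_2\})\cup(N(x_1)\triangle N(x_2))$; twin-width is the minimum over contraction sequences to one vertex of the maximum red degree;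 bounded for a class if some constant bounds it on all members. *)

(* Defs.v *)
From HB Require Import structures.
From mathcomp Require Import all_boot all_order all_algebra all_fingroup.
From mathcomp Require Import boolp reals.
Set Implicit Arguments.
Unset Strict Implicit.
Unset Printing Implicit Defensive.

Record sgraph := SGraph {
  svertex :> finType;
  adj : rel svertex;
  adj_sym : symmetric adj;
  adj_irrefl : irreflexive adj }.

Definition induced_embedding (H G : sgraph) (f : H -> G) : Prop :=
  injective f /\ {mono f : u v / adj u v}.

Definition induced_subgraph (H G : sgraph) : Prop :=
  exists f : H -> G, induced_embedding f.

Definition isomorphic (G H : sgraph) : Prop :=
  exists f : G -> H, bijective f /\ {mono f : u v / adj u v}.

(* Since [induced_subgraph] is taken up to isomorphism, a hereditary class is
   in particular closed under isomorphism. *)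
Definition hereditary (C : sgraph -> Prop) : Prop :=
  forall G H : sgraph, C G -> induced_subgraph H G -> C H.

(* No restriction on the kind of intervals: endpoints may be open, closed or
   infinite. *)
Definition interval_graph (R : realType) (G : sgraph) : Prop :=
  exists J : G -> interval R,
    forall u v : G, u != v ->
      (adj u v <-> exists x : R, x \in J u /\ x \in J v).

Section Perturbation.
Variables (G : sgraph) (X : {set G}).

Definition perturb_adj : rel G :=
  fun u v => adj u v (+) [&& u != v, u \in X & v \in X].

Fact perturb_sym : symmetric perturb_adj.
Proof.
by move=> u v; rewrite /perturb_adj adj_sym eq_sym [(u \in X) && _]andbC.
Qed.

Fact perturb_irrefl : irreflexive perturb_adj.
Proof. by move=> u; rewrite /perturb_adj adj_irrefl eqxx. Qed.

Definition elementary_perturbation : sgraph :=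
  SGraph perturb_sym perturb_irrefl.
End Perturbation.

(* [bounded_perturbation r G H]: H results from G by at most r elementary
   perturbations. *)
Inductive bounded_perturbation : nat -> sgraph -> sgraph -> Prop :=
| perturb_none r (G : sgraph) : bounded_perturbation r G G
| perturb_one r (G : sgraph) (X : {set G}) (H : sgraph) :
    bounded_perturbation r (elementary_perturbation X) H ->
    bounded_perturbation r.+1 G H.

Definition perturbed_interval_graph (R : realType) (r : nat) (G : sgraph) :=
  exists I H : sgraph,
    [/\ interval_graph R I, bounded_perturbation r I H & isomorphic H G].

(* The permuted set {1, ..., p} is encoded as 'I_p = {0, ..., p-1}. *)
Definition exposes (p : nat) (pi : 'S_p) (H : sgraph) : Prop :=
  exists (w : 'I_p -> H) (W1 W2 : {set H}),
    let W := [set w i | i : 'I_p] in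
    let N1 i := [set x in W1 | adj (w i) x] in
    let N2 i := [set x in W2 | adj (w i) x] in
    [/\ injective w,
        [/\ W :|: W1 :|: W2 = setT,
            [disjoint W & W1], [disjoint W & W2] & [disjoint W1 & W2]],
        #|W1| = p /\ #|W2| = p,
        forall i : 'I_p, N1 i != set0 /\ N2 i != set0 &
        forall i j : 'I_p, i < j ->
          N1 i \proper N1 j /\ N2 (pi i) \proper N2 (pi j)].

Definition excludes (C D : sgraph -> Prop) : Prop :=
  forall G H : sgraph, C G -> D H -> ~ isomorphic G H.

(* [tadj] relates all adjacent vertices, whether the edge is black or red, so
   that N(x) = {y | tadj x y} and N_r(x) = {y | tred x y}. *)
Record trigraph := Trigraph {
  tvertex :> finType;
  tadj : rel tvertex;
  tred : rel tvertex;
  tadj_sym : symmetric tadj;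
  tadj_irrefl : irreflexive tadj;
  tred_sym : symmetric tred;
  tred_adj : subrel tred tadj }.

Definition trigraph_of (G : sgraph) : trigraph :=
  @Trigraph G (@adj G) (fun _ _ => false) (@adj_sym G) (@adj_irrefl G)
    (fun _ _ => erefl) (fun _ _ => fun h : false => False_ind _ (notF h)).

Section Contraction.
Variables (T : trigraph) (x1 x2 : T).

(* [None] is the new vertex x0; the others are the vertices of T other than
   x1 and x2. *)
Definition contract_vertex : finType :=
  option {y : T | (y != x1) && (y != x2)}.

Definition contract_adj : rel contract_vertex := fun u v =>
  match u, v with
  | None, None => false
  | Some a, Some b => tadj (val a) (val b)
  | None, Some b | Some b, None => tadj x1 (val b) || tadj x2 (val b)
  end.

Definition contract_red : rel contract_vertex := fun u v =>
  match u, v with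
  | None, None => false
  | Some a, Some b => tred (val a) (val b)
  | None, Some b | Some b, None =>
      [|| tred x1 (val b), tred x2 (val b)
        | tadj x1 (val b) (+) tadj x2 (val b)]
  end.

Fact contract_adj_sym : symmetric contract_adj.
Proof. by move=> [a|] [b|] //=; rewrite tadj_sym. Qed.

Fact contract_adj_irrefl : irreflexive contract_adj.
Proof. by move=> [a|] //=; rewrite tadj_irrefl. Qed.

Fact contract_red_sym : symmetric contract_red.
Proof. by move=> [a|] [b|] //=; rewrite tred_sym. Qed.

Fact contract_red_adj : subrel contract_red contract_adj.
Proof.
have aux y : [|| tred x1 y, tred x2 y | tadj x1 y (+) tadj x2 y] ->
    tadj x1 y || tadj x2 y.
  by case/or3P=> [/tred_adj->|/tred_adj->|]; rewrite ?orbT //;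
    case: (tadj x1 y); case: (tadj x2 y).
by move=> [a|] [b|] //=; [apply: tred_adj|apply: aux|apply: aux].
Qed.

Definition contract : trigraph :=
  Trigraph contract_adj_sym contract_adj_irrefl contract_red_sym
    contract_red_adj.

Fact card_contract : x1 != x2 -> #|T| = #|contract|.+1.
Proof.
move=> x12; rewrite [#|contract|]card_option card_sig.
rewrite (cardD1 x1) (cardD1 x2) !inE eq_sym x12 !add1n; congr _.+2.
by apply: eq_card => y; rewrite !inE andbT andbC.
Qed.
End Contraction.

(* Ending at a trigraph with at most one vertex, instead of exactly one, only
   serves to give the empty graph a twin-width (namely 0). *)
Inductive contraction_sequence (T : trigraph) : Type :=
| contraction_done of #|T| <= 1
| contraction_step (x1 x2 : T) of x1 != x2
    & contraction_sequence (contract x1 x2).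

Definition max_red_degree (T : trigraph) : nat :=
  \max_(x : T) #|[set y : T | tred x y]|.

Fixpoint width (T : trigraph) (s : contraction_sequence T) : nat :=
  match s with
  | contraction_done _ => max_red_degree T
  | contraction_step _ _ _ s' => maxn (max_red_degree T) (width s')
  end.

Fact contraction_sequence_exists (T : trigraph) :
  inhabited (contraction_sequence T).
Proof.
have [n] := ubnP #|T|; elim: n T => // n IHn T leTn.
case: (leqP #|T| 1) => [T1|]; first by split; apply: contraction_done.
case/card_gt1P=> x1 [x2 [_ _ x12]].
have [|s] := IHn (contract x1 x2); first by rewrite -card_contract.
by split; apply: contraction_step x12 s.
Qed.

Definition is_width (T : trigraph) : pred nat :=
  fun k => `[< exists s : contraction_sequence T, width s = k >].

Fact is_width_exists (T : trigraph) : exists k, is_width T k.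
Proof.
by have [s] := contraction_sequence_exists T; exists (width s); apply/asboolP; exists s.
Qed.

Definition twin_width (G : sgraph) : nat :=
  ex_minn (is_width_exists (trigraph_of G)).

Definition bounded_twin_width (C : sgraph -> Prop) : Prop :=
  exists k : nat, forall G : sgraph, C G -> twin_width G <= k.

(* Main.v *)
(* Contracting vertices amounts to coarsening a partition of the graph, a pair of
   parts being red when it is neither complete nor empty.

   Bounded twin-width excludes some R^+_pi: let pi swap the two digits in base m,
   so that every block of m consecutive positions in one order is spread over all
   of the other order. Let a contraction be the first to produce a part that is
   long in one of the two orders. The vertices of W_1 (or W_2) inside that range
   distinguish two elements of the part, so they lie in few parts; hence two of
   them that are far apart lie in the same part, and they distinguish all w_i
   between them, so that a whole block of the w_i lies in few parts. Before the
   contraction these parts were short in the other order, over which the block is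
   spread: a contradiction for m large.

   Conversely, an r-bounded perturbation of an interval graph is given by intervals
   [a, b] and a colouring by 2^r types. The ends are shifted so that different
   left (right) ends are separated by a right (left) end, and placed on a line.
   If the points (left end, right end) of one type contain a large grid, then
   any permutation can be selected in it, and the separating vertices
   provide W_1 and W_2. Otherwise, by the Marcus-Tardos theorem, any division of
   the line into s parts has O(s) nonempty cells, so two consecutive
   parts can be merged while every part keeps boundedly many cells;
   two cells are homogeneous unless the left part of one is the right part of the
   other. *)

Require Import Defs.
From HB Require Import structures.
From mathcomp Require Import all_boot all_order all_algebra all_fingroup.
From mathcomp Require Import boolp reals.
From mathcomp Require Import zify.
Set Implicit Arguments.
Unset Strict Implicit.
Unset Printing Implicit Defensive.

(** * Trigraphs as partitions *)

(** The parts are the fibres of [q]. Redness is read off from [G] alone, so the history of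
    contractions need not be remembered. *)
Definition represents (G : sgraph) (T : trigraph) (q : G -> T) : Prop :=
  [/\ forall x, exists u, q u = x,
      forall x y, tadj x y <->
        x <> y /\ exists u v, [/\ q u = x, q v = y & adj u v] &
      forall x y, tred x y <->
        [/\ x <> y, exists u v, [/\ q u = x, q v = y & adj u v] &
         exists u v, [/\ q u = x, q v = y & ~~ adj u v]]].

Lemma represents_id (G : sgraph) : @represents G (trigraph_of G) id.
Proof.
split=> [x|x y|x y]; first by exists x.
- split=> [xy|[_ [u [v [<- <- //]]]]].
  split; last by exists x, y.
  by move=> E; move: xy; rewrite E /= adj_irrefl.
- by split=> // -[_ [u [v [-> -> uv]]] [u' [v' [-> ->]]]]; rewrite uv.
Qed.

Definition contract_map (T : trigraph) (x1 x2 y : T) : contract x1 x2 := insub y.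

Lemma contract_mapP (T : trigraph) (x1 x2 y : T) :
  (exists2 z, contract_map x1 x2 y = Some z & val z = y) \/
  (contract_map x1 x2 y = None /\ (y = x1 \/ y = x2)).
Proof.
rewrite /contract_map; case: insubP => [z _ E|]; first by left; exists z.
rewrite negb_and !negbK => /orP yE; right; split=> //.
by case: yE => /eqP; [left|right].
Qed.

(** Only [x1] and [x2] are identified, so one extra bit recovers the part before the contraction
    from the part after it. *)
Lemma contract_map_eq (T : trigraph) (x1 x2 y y' : T) :
  contract_map x1 x2 y = contract_map x1 x2 y' -> (y == x1) = (y' == x1) ->
  y = y'.
Proof.
case: (contract_mapP x1 x2 y) => [[z -> <-]|[-> yE]];
  case: (contract_mapP x1 x2 y') => [[z' -> <-]|[-> y'E]] //.
  by case=> ->.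
move=> _; case: yE => ->; case: y'E => -> //; rewrite eqxx.
  by move/esym/eqP.
by move/eqP.
Qed.

Lemma contract_map_Some (T : trigraph) (x1 x2 y : T) a :
  contract_map x1 x2 y = Some a <-> y = val a.
Proof.
split=> [|->]; last by rewrite /contract_map valK.
by case: (contract_mapP x1 x2 y) => [[z -> <-] [->]|[-> _]].
Qed.

Lemma contract_map_None (T : trigraph) (x1 x2 y : T) :
  contract_map x1 x2 y = None <-> y = x1 \/ y = x2.
Proof.
split; last by case=> ->; rewrite /contract_map insubN ?eqxx ?andbF.
by case: (contract_mapP x1 x2 y) => [[z -> _]|[]].
Qed.

(** The merged fibre is mixed with another one if one of its halves was, or if both halves are
    homogeneous but of opposite kinds; the latter is the symmetric difference in the red rule. *)
Lemma represents_contract (G : sgraph) (T : trigraph) (q : G -> T) (x1 x2 : T) :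
  represents q -> represents (contract_map x1 x2 \o q).
Proof.
case=> qS qA qR.
have nval (a : {y : T | (y != x1) && (y != x2)}) : x1 <> val a /\ x2 <> val a.
  by case/andP: (valP a) => /eqP n1 /eqP n2; split=> /esym.
have A0 (b : {y : T | (y != x1) && (y != x2)}) : tadj x1 (val b) || tadj x2 (val b) <->
    exists u v, [/\ q u = x1 \/ q u = x2, q v = val b & adj u v].
  have [n1 n2] := nval b.
  split.
    by case/orP=> /qA[_ [u [v [qu qv uv]]]]; exists u, v; split; auto.
  case=> u [v [[] qu qv uv]]; apply/orP; [left|right]; apply/qA;
    by split=> //; exists u, v.
have sadj u v : adj u v = adj v u :> bool by apply: adj_sym.
have R0 (b : {y : T | (y != x1) && (y != x2)}) :
    [|| tred x1 (val b), tred x2 (val b) | tadj x1 (val b) (+) tadj x2 (val b)]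
    <-> (exists u v, [/\ q u = x1 \/ q u = x2, q v = val b & adj u v]) /\
        (exists u v, [/\ q u = x1 \/ q u = x2, q v = val b & ~~ adj u v]).
  have [n1 n2] := nval b.
  have [u1 qu1] := qS x1; have [u2 qu2] := qS x2; have [vb qvb] := qS (val b).
  split.
    case/or3P.
    - case/qR=> _ [u [v [qu qv uv]]] [u' [v' [qu' qv' uv']]].
      by split; [exists u, v|exists u', v']; split; auto.
    - case/qR=> _ [u [v [qu qv uv]]] [u' [v' [qu' qv' uv']]].
      by split; [exists u, v|exists u', v']; split; auto.
    - case E1: (tadj x1 _); case E2: (tadj x2 _) => // _.
      + split; first by apply/A0; rewrite E1.
        exists u2, vb; split; auto; apply/negP => uv.
        by move/negP: (negbT E2); apply; apply/qA; split=> //; exists u2, vb.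
      + split; first by apply/A0; rewrite E2 orbT.
        exists u1, vb; split; auto; apply/negP => uv.
        by move/negP: (negbT E1); apply; apply/qA; split=> //; exists u1, vb.
  case=> [[u [v [qu qv uv]]] [u' [v' [qu' qv' uv']]]].
  have [E1|E1] := boolP (tred x1 (val b)) => //=.
  have [E2|E2] := boolP (tred x2 (val b)) => //=.
  have K x (nx : x <> val b) (nr : ~~ tred x (val b)) z : q z = x ->
      forall t, q t = val b -> adj z t = tadj x (val b).
    move=> qz t qt; apply/idP/idP => [zt|]; first by apply/qA; split=> //; exists z, t.
    move=> xb; apply: contraNT nr => zt; apply/qR.
    by case/qA: xb => _ ?; split=> //; exists z, t.
  move: uv uv'.
  case: qu => qu; [rewrite (K _ n1 E1 _ qu _ qv)|rewrite (K _ n2 E2 _ qu _ qv)];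
  case: qu' => qu'; [rewrite (K _ n1 E1 _ qu' _ qv')|rewrite (K _ n2 E2 _ qu' _ qv')
    |rewrite (K _ n1 E1 _ qu' _ qv')|rewrite (K _ n2 E2 _ qu' _ qv')];
  by do 2!case: tadj.
split=> [x|x y|x y].
- case: x => [a|]; first by have [u qu] := qS (val a); exists u; apply/contract_map_Some.
  by have [u qu] := qS x1; exists u; apply/contract_map_None; left.
- case: x y => [a|] [b|] /=.
  + rewrite qA; split=> -[ne [u [v [qu qv uv]]]]; split.
    * by case=> E; apply: ne; rewrite E.
    * by exists u, v; split=> //; apply/contract_map_Some.
    * by move=> /val_inj E; apply: ne; rewrite E.
    * by exists u, v; split=> //; apply/contract_map_Some.
  + rewrite A0; split=> [[u [v [qu qv uv]]]|[_ [u [v [qu qv uv]]]]].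
      split=> //; exists v, u; rewrite sadj; split=> //; first exact/contract_map_Some.
      exact/contract_map_None.
    exists v, u; rewrite sadj; split=> //; first exact/contract_map_None.
    exact/(@contract_map_Some T x1 x2).
  + rewrite A0; split=> [[u [v [qu qv uv]]]|[_ [u [v [qu qv uv]]]]].
      split=> //; exists u, v; split=> //; first exact/contract_map_None.
      exact/contract_map_Some.
    exists u, v; split=> //; first exact/contract_map_None.
    exact/(@contract_map_Some T x1 x2).
  + by split=> // -[].
- case: x y => [a|] [b|] /=.
  + rewrite qR; split=> -[ne [u [v [qu qv uv]]] [u' [v' [qu' qv' uv']]]]; split.
    * by case=> E; apply: ne; rewrite E.
    * by exists u, v; split=> //; apply/contract_map_Some.
    * by exists u', v'; split=> //; apply/contract_map_Some.
    * by move=> /val_inj E; apply: ne; rewrite E.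
    * by exists u, v; split=> //; apply/contract_map_Some.
    * by exists u', v'; split=> //; apply/contract_map_Some.
  + rewrite R0; split=> [[[u [v [qu qv uv]]] [u' [v' [qu' qv' uv']]]]
      |[_ [u [v [qu qv uv]]] [u' [v' [qu' qv' uv']]]]].
      split=> //; [exists v, u|exists v', u']; rewrite sadj; split=> //.
      - exact/contract_map_Some.
      - exact/contract_map_None.
      - exact/contract_map_Some.
      - exact/contract_map_None.
    split; [exists v, u|exists v', u']; rewrite sadj; split=> //.
    - exact/contract_map_None.
    - exact/(@contract_map_Some T x1 x2).
    - exact/contract_map_None.
    - exact/(@contract_map_Some T x1 x2).
  + rewrite R0; split=> [[[u [v [qu qv uv]]] [u' [v' [qu' qv' uv']]]]
      |[_ [u [v [qu qv uv]]] [u' [v' [qu' qv' uv']]]]].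
      split=> //; [exists u, v|exists u', v']; split=> //.
      - exact/contract_map_None.
      - exact/contract_map_Some.
      - exact/contract_map_None.
      - exact/contract_map_Some.
    split; [exists u, v|exists u', v']; split=> //.
    - exact/contract_map_None.
    - exact/(@contract_map_Some T x1 x2).
    - exact/contract_map_None.
    - exact/(@contract_map_Some T x1 x2).
  + by split=> // -[].
Qed.

(** * Lower bounds on the width from two orders *)

Lemma pigeonhole (T : finType) (A : {set T}) N (h : nat -> T) :
  (forall z, z < N -> h z \in A) -> #|A| < N ->
  exists z1 z2, [/\ z1 < z2, z2 < N & h z1 = h z2].
Proof.
move=> hA AN; apply: contrapT => no.
have inj : injective (fun z : 'I_N => h z).
  move=> z z' E; apply/val_inj/eqP; rewrite eqn_leq; apply: contrapT => ne.
  apply: no; have := ltn_ord z; have := ltn_ord z'.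
  by case: (ltngtP z z') ne => // lt _ ? ?; [exists z, z'|exists z', z].
have := max_card (mem (codom (fun z : 'I_N => h z))).
have : #|[set h z | z : 'I_N]| <= #|A|.
  by apply/subset_leq_card/subsetP => _ /imsetP[z _ ->]; apply: hA.
by rewrite card_imset // card_ord leqNgt AN.
Qed.

Lemma max_red_degreeP (T : trigraph) k (x : T) :
  max_red_degree T <= k -> #|x |: [set y | tred x y]| <= k.+1.
Proof.
move=> Tk; apply: leq_trans (leq_card_setU _ _) _; rewrite cards1 add1n ltnS.
by apply: leq_trans Tk; apply: (@leq_bigmax _ (fun x => #|[set y : T | tred x y]|)).
Qed.

Lemma represents_red (G : sgraph) (T : trigraph) (q : G -> T) (u v y : G) :
  represents q -> q u = q v -> adj u y != adj v y ->
  q y \in q u |: [set z | tred (q u) z].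
Proof.
case=> _ _ qR quv ad; rewrite !inE eq_sym; case: eqP => //= ne; apply/qR; split=> //.
  by case E: (adj u y) ad; [exists u, y|case E': (adj v y) => // _; exists v, y].
case E: (adj u y) ad; last by exists u, y; rewrite E.
by case E': (adj v y) => // _; exists v, y; rewrite E'.
Qed.

(* [e] indexes the vertices w; [f] and [g] are their ranks in the two orders *)
Lemma spread_propagates (G : sgraph) (T : trigraph) (q : G -> T) (x1 x2 : T)
    (I : Type) (e : I -> G) (f g : I -> nat) (X : nat -> G) (k m : nat) :
  let q' := contract_map x1 x2 \o q in
  let D := (k.+1 * (2 * m)).+1 in
  (2 * k + 3) ^ 2 <= m ->
  represents q' -> max_red_degree (contract x1 x2) <= k ->
  (forall i z, 0 < z < m * m -> adj (e i) (X z) = (z <= f i)) ->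
  (forall i, f i < m * m) ->
  (forall a t, a < m -> t < m -> exists j, f j = a * m + t /\ g j = t * m + a) ->
  (forall i j, q (e i) = q (e j) -> g i < g j + D) ->
  forall i j, q' (e i) = q' (e j) -> f i < f j + D.
Proof.
move=> q' D mE rq' dk Xadj fm grid small i j qij; rewrite ltnNge; apply/negP => far.
have m0 : 0 < m by lia.
(* These [k + 2] separators have ranks in the interval from [f j + 1] to [f j + D <= f i]. All
   distinguish [e i] from [e j], so they lie in at most [k + 1] parts. *)
have [z1 [z2 [z12 z2k EX]]] : exists z1 z2, [/\ z1 < z2, z2 < k.+2 &
    q' (X (f j + 1 + z1 * (2 * m))) = q' (X (f j + 1 + z2 * (2 * m)))].
  apply: (@pigeonhole _ (q' (e i) |: [set y | tred (q' (e i)) y]) k.+2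
     (fun z => q' (X (f j + 1 + z * (2 * m))))).
    move=> z zk; apply: (@represents_red _ _ q' (e i) (e j)) => //.
    have fi := fm i; have zb : z * (2 * m) <= k.+1 * (2 * m) by rewrite leq_mul.
    by rewrite !Xadj //; lia.
  exact: max_red_degreeP.
set k1 := f j + 1 + z1 * (2 * m) in EX; set k2 := f j + 1 + z2 * (2 * m) in EX.
have k12 : k1 + 2 * m <= k2.
  by rewrite /k1 /k2 -addnA leq_add2l addnC -mulSn leq_mul.
have k2b : k2 <= f i.
  have := leq_mul z2k (leqnn (2 * m)); rewrite mulSn /k2; move: far; rewrite /D mulSn; lia.
(* The gap of [2 * m] contains a full block of [m] ranks starting at [a * m]; its members are
   adjacent to [X k1] and not to [X k2]. *)
pose a := (k1 %/ m).+1.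
have am : a * m <= k1 + m /\ k1 <= a * m.
  by rewrite /a mulSn; have := divn_eq k1 m; have := ltn_pmod k1 m0; lia.
have fi := fm i.
have alt : a < m by rewrite -(ltn_pmul2r m0); lia.
have /choice [J JP] : forall t, exists j, t < m -> f j = a * m + t /\ g j = t * m + a.
  move=> t; case: (ltnP t m) => tm; last by exists i.
  by have [j' ?] := grid a t alt tm; exists j'.
(* The block meets at most [k + 1] new parts, hence at most [2 * k + 2] old ones. Of [2 * k + 3]
   members taken [E] apart, two share an old part although their [g] differ by at least
   [E * m >= D]. *)
pose E := 2 * k + 3.
have EE z : z < (2 * k + 3) -> z * E < m.
  move=> zl; apply: leq_trans mE; rewrite /E -mulnn ltn_pmul2r; lia.
have [y1 [y2 [y12 y2k EY]]] : exists y1 y2, [/\ y1 < y2, y2 < 2 * k + 3 &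
    (q' (e (J (y1 * E))), q (e (J (y1 * E))) == x1) =
    (q' (e (J (y2 * E))), q (e (J (y2 * E))) == x1)].
  apply: (@pigeonhole _ (setX (q' (X k1) |: [set y | tred (q' (X k1)) y]) [set: bool])
      (2 * k + 3) (fun z => (q' (e (J (z * E))), q (e (J (z * E))) == x1))).
    move=> z zk; rewrite in_setX in_setT andbT.
    apply: (@represents_red _ _ q' (X k1) (X k2)) => //.
    have [Jf _] := JP _ (EE _ zk); have lt := EE _ zk.
    by rewrite [adj (X k1) _]adj_sym [adj (X k2) _]adj_sym !Xadj ?Jf; lia.
  have := max_red_degreeP (q' (X k1)) dk.
  by rewrite cardsX cardsT card_bool; lia.
case: EY => /contract_map_eq H /H Eq.
have := small _ _ (esym Eq).
have [_ ->] := JP _ (EE _ y2k); have [_ ->] := JP _ (EE _ (ltn_trans y12 y2k)).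
have : (y1 * E + E) * m <= y2 * E * m.
  by rewrite leq_mul // -mulSnr leq_mul.
rewrite /D /E !mulnDl mulSn; move: m0; clear; nia.
Qed.

Lemma max_red_width (T : trigraph) (s : contraction_sequence T) :
  max_red_degree T <= width s.
Proof. by case: s => //= *; apply: leq_maxl. Qed.

(** While red degrees stay at most [k], two [e] in one part differ by less than [D] in both ranks:
    each bound follows from the previous bound on the other rank. A single final part violates this,
    since the ranks [0] and [(m - 1) * m] both occur. *)
Lemma grid_width (G : sgraph) (T : trigraph) (q : G -> T)
    (I : Type) (e : I -> G) (f g : I -> nat) (X Y : nat -> G) (k m : nat) :
  let D := (k.+1 * (2 * m)).+1 in
  (2 * k + 3) ^ 2 <= m ->
  represents q ->
  (forall i z, 0 < z < m * m -> adj (e i) (X z) = (z <= f i)) ->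
  (forall i z, 0 < z < m * m -> adj (e i) (Y z) = (z <= g i)) ->
  (forall i, f i < m * m) -> (forall i, g i < m * m) ->
  (forall a t, a < m -> t < m -> exists j, f j = a * m + t /\ g j = t * m + a) ->
  (forall i j, q (e i) = q (e j) -> f i < f j + D /\ g i < g j + D) ->
  forall s : contraction_sequence T, k < width s.
Proof.
move=> D mE rq XP YP fm gm grid + s; rewrite ltnNge.
elim: s q rq => {T} [T T1|T x1 x2 x12 s IHs] q rq small.
  have m0 : 0 < m by lia.
  have [i [fi _]] := grid 0 0 m0 m0.
  have [j [fj _]] := grid m.-1 0 ltac:(lia) m0.
  have /small : q (e j) = q (e i) by apply/(fintype_le1P T1).
  rewrite fi fj; move: mE; rewrite /D -mulnn; clear; nia.
apply/negP; rewrite /= geq_max => /andP[_ sk].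
have rq' := represents_contract x1 x2 rq.
have dk := leq_trans (max_red_width s) sk.
suff /(IHs _ rq')/negP : forall i j,
  contract_map x1 x2 (q (e i)) = contract_map x1 x2 (q (e j)) ->
  f i < f j + D /\ g i < g j + D by [].
move=> i j qij; split.
  apply: (spread_propagates (q := q) (X := X) (k := k) (g := g)) qij => //.
  by move=> i' j' /small[].
apply: (spread_propagates (q := q) (X := Y) (k := k) (g := f)) qij => //.
  by move=> a t am tm; have [j' []] := grid t a tm am; exists j'.
by move=> i' j' /small[].
Qed.

(** [X z] is an element of [N z] outside the preceding set of the chain; [x0] only fills the values
    out of range. *)
Lemma chain_separators (V : finType) (p : nat) (N : 'I_p -> {set V}) (x0 : V) :
  (forall i j : 'I_p, i < j -> N i \proper N j) ->
  exists X : nat -> V, forall (i : 'I_p) z, 0 < z < p -> (X z \in N i) = (z <= i).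
Proof.
move=> chain; have subN (i j : 'I_p) : i <= j -> N i \subset N j.
  by rewrite leq_eqVlt => /orP[/eqP/val_inj ->//|/chain/proper_sub].
suff /choice [X XP] : forall z, exists x, forall i : 'I_p,
    0 < z < p -> (x \in N i) = (z <= i).
  by exists X => i z; apply: XP.
move=> z; case: (boolP (0 < z < p)) => [/andP[z0 zp]|]; last by exists x0.
have zp' : z.-1 < p by lia.
have /properP[_ [x xz xz']] := chain (Ordinal zp') (Ordinal zp) ltac:(by rewrite /= prednK).
exists x => i _; case: leqP => zi.
  by apply: (subsetP (subN (Ordinal zp) i zi)).
apply: contraNF xz'; apply: (subsetP (subN i (Ordinal zp') _)).
by rewrite /=; lia.
Qed.

Lemma swap_digits_subproof m (i : 'I_(m * m)) : (i %% m) * m + i %/ m < m * m.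
Proof.
have m0 : 0 < m by case: m i => [[]|].
have := ltn_pmod i m0; have : i %/ m < m by rewrite ltn_divLR.
move: (i %% m) (i %/ m) => a b; clear; nia.
Qed.

Definition swap_digits m (i : 'I_(m * m)) : 'I_(m * m) := Ordinal (swap_digits_subproof i).

Lemma swap_digitsK m : involutive (@swap_digits m).
Proof.
move=> i; apply: val_inj => /=.
have m0 : 0 < m by case: m i => [[]|].
have lt : i %/ m < m by rewrite ltn_divLR.
by rewrite modnMDl (modn_small lt) divnMDl // (divn_small lt) addn0 -divn_eq.
Qed.

Definition swap_digits_perm m : 'S_(m * m) := perm (can_inj (@swap_digitsK m)).

(** The two ranks of [w i] are its places in the two chains. The second is given by the inverse
    permutation, which is the digit swap itself. *)
Lemma exposes_width (H : sgraph) k m (s : contraction_sequence (trigraph_of H)) :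
  (2 * k + 3) ^ 2 <= m -> exposes (swap_digits_perm m) H -> k < width s.
Proof.
move=> mE [w [W1 [W2 [winj _ _ _ NN]]]].
have mm0 : 0 < m * m by move: mE; rewrite -mulnn; clear; nia.
have [X XP] := chain_separators (w (Ordinal mm0)) (fun i j ij => (NN i j ij).1).
have [Y YP] := chain_separators (w (Ordinal mm0)) (fun i j ij => (NN i j ij).2).
have {}XP i z : 0 < z < m * m -> adj (w i) (X z) = (z <= i).
  move=> z0; have /andP[_ zm] := z0; have := XP i z z0.
  by have := XP (Ordinal zm) z z0; rewrite /= leqnn !inE => /andP[-> _].
have {}YP i z : 0 < z < m * m -> adj (w i) (Y z) = (z <= swap_digits i).
  move=> z0; have /andP[_ zm] := z0; have := YP (swap_digits i) z z0.
  have := YP (Ordinal zm) z z0; rewrite /= leqnn !inE => /andP[-> _].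
  by rewrite permE swap_digitsK.
apply: (grid_width (G := H) (T := trigraph_of H) (q := id) (e := w) (f := val)
  (g := val \o @swap_digits m)
  (X := X) (Y := Y) (m := m)) => //.
- exact: represents_id.
- by move=> i; apply: ltn_ord.
- by move=> i; apply: ltn_ord.
- move=> a t am tm; have lt : a * m + t < m * m by move: am tm; clear; nia.
  exists (Ordinal lt); split=> //=.
  by rewrite modnMDl modn_small // divnMDl ?divn_small ?addn0 //; lia.
- by move=> i j /winj ->; split; rewrite addnS ltnS leq_addr.
Qed.

Lemma twin_widthP (G : sgraph) :
  exists s : contraction_sequence (trigraph_of G), width s = twin_width G.
Proof. by rewrite /twin_width; case: ex_minnP => k /asboolP. Qed.

Lemma twin_width_le (G : sgraph) k (s : contraction_sequence (trigraph_of G)) :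
  width s <= k -> twin_width G <= k.
Proof.
move=> sk; rewrite /twin_width; case: ex_minnP => n _ nmin.
by apply: leq_trans (nmin _ _) sk; apply/asboolP; exists s.
Qed.

Lemma isomorphic_induced (G H : sgraph) : isomorphic G H -> induced_subgraph H G.
Proof.
case=> f [[g fK gK] fm]; exists g; split; first exact: can_inj gK.
by move=> u v; rewrite -fm !gK.
Qed.

Lemma bounded_twin_width_excludes (C : sgraph -> Prop) :
  hereditary C -> bounded_twin_width C ->
  exists (p : nat) (pi : 'S_p), 0 < p /\ excludes C (exposes pi).
Proof.
move=> hC [k kP]; pose m := (2 * k + 3) ^ 2.
exists (m * m), (swap_digits_perm m); split.
  by rewrite /m -mulnn; clear; nia.
move=> G H CG eH /isomorphic_induced HG.
have [s sE] := twin_widthP H.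
have := exposes_width s (leqnn m) eH.
by rewrite sE ltnNge kP //; apply: hC HG.
Qed.

(** * The Marcus-Tardos theorem *)

(** Counts nonempty cells when [f] gives the coordinates of a cell. A list allows an infinite
    codomain, such as pairs of naturals. *)
Definition distinct (V : finType) (A : eqType) (f : V -> A) (P : pred V) : nat :=
  size (undup [seq f v | v <- enum P]).

Section Distinct.
Variable V : finType.
Implicit Types (P Q R : pred V).

Lemma mem_distinct (A : eqType) (f : V -> A) P a :
  reflect (exists2 v, P v & a = f v) (a \in undup [seq f v | v <- enum P]).
Proof.
rewrite mem_undup; apply: (iffP mapP) => -[v vP ->]; exists v => //.
  by move: vP; rewrite mem_enum.
by rewrite mem_enum.
Qed.

Lemma distinct_le_size (A : eqType) (f : V -> A) P (s : seq A) :
  (forall v, P v -> f v \in s) -> distinct f P <= size s.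
Proof.
move=> fs; apply: uniq_leq_size (undup_uniq _) _ => a /mem_distinct[v vP ->].
exact: fs.
Qed.

Lemma distinctS (A : eqType) (f : V -> A) P Q :
  {subset P <= Q} -> distinct f P <= distinct f Q.
Proof. by move=> PQ; apply: distinct_le_size => v /PQ Qv; apply/mem_distinct; exists v. Qed.

Lemma distinctU (A : eqType) (f : V -> A) P Q R :
  (forall v, P v -> Q v || R v) -> distinct f P <= distinct f Q + distinct f R.
Proof.
move=> PQR; rewrite -size_cat; apply: distinct_le_size => v /PQR.
by rewrite mem_cat => /orP[vQ|vR]; apply/orP; [left|right]; apply/mem_distinct; exists v.
Qed.

Lemma distinct_mul (A B : eqType) (f : V -> A) (g : V -> B) P m :
  (forall v0, P v0 -> distinct f (fun v => P v && (g v == g v0)) <= m) ->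
  distinct f P <= m * distinct g P.
Proof.
move=> fib.
pose F b := undup [seq f v | v <- enum (fun v => P v && (g v == b))].
apply: leq_trans (_ : size (flatten [seq F b | b <- undup [seq g v | v <- enum P]]) <= _).
  apply: distinct_le_size => v vP; apply/flattenP; exists (F (g v)).
    by apply/mapP; exists (g v) => //; apply/mem_distinct; exists v.
  by apply/mem_distinct; exists v => //; rewrite vP eqxx.
rewrite size_flatten /shape -map_comp mulnC /distinct.
have: {in undup [seq g v | v <- enum P], forall b, size (F b) <= m}.
  by move=> _ /mem_distinct[v vP ->]; apply: fib.
elim: (undup _) => //= b s IHs sm.
rewrite mulSn leq_add // ?sm ?mem_head // IHs // => b' b's.
by apply: sm; rewrite inE b's orbT.
Qed.

Lemma distinct_factor (A B : eqType) (f : V -> A) (g : V -> B) P :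
  (forall u v, P u -> P v -> g u = g v -> f u = f v) ->
  distinct f P <= distinct g P.
Proof.
move=> gf; rewrite -[leqRHS]mul1n; apply: distinct_mul => v0 Pv0.
apply: (@distinct_le_size _ _ _ [:: f v0]) => v /andP[Pv /eqP gv].
by rewrite inE (gf v v0).
Qed.

Lemma distinct_pair (A B : eqType) (f : V -> A) (g : V -> B) P :
  distinct (fun v => (f v, g v)) P <= distinct f P * distinct g P.
Proof.
apply: distinct_mul => v0 Pv0.
apply: leq_trans (_ : distinct f (fun v => P v && (g v == g v0)) <= _).
  by apply: distinct_factor => u v /andP[_ /eqP->] /andP[_ /eqP->] ->.
by apply: distinctS => v /andP[].
Qed.

Lemma distinct_range (x : V -> nat) P lo n :
  (forall v, P v -> lo <= x v < lo + n) -> distinct x P <= n.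
Proof.
move=> xn; rewrite -[leqRHS](size_iota lo); apply: distinct_le_size => v /xn.
by rewrite mem_iota.
Qed.

Lemma distinct_card (T : finType) (f : V -> T) P : distinct f P <= #|T|.
Proof. by rewrite cardT; apply: distinct_le_size => v _; rewrite mem_enum. Qed.

Lemma distinct_disjoint (A : eqType) (f : V -> A) P Q R :
  (forall u v, P u -> Q v -> f u != f v) ->
  (forall v, P v || Q v -> R v) ->
  distinct f P + distinct f Q <= distinct f R.
Proof.
move=> PQ PQR; rewrite -size_cat; apply: uniq_leq_size.
  rewrite cat_uniq !undup_uniq /= andbT; apply/hasPn => _ /mem_distinct[v Qv ->].
  by apply/negP => /mem_distinct[u Pu /esym/eqP]; apply/negP/PQ.
move=> a; rewrite mem_cat => /orP[] /mem_distinct[v vP ->]; apply/mem_distinct;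
  by exists v => //; apply: PQR; rewrite vP ?orbT.
Qed.

Lemma sum_distinct_fibers (A : eqType) (f : V -> A) (h : V -> nat) P n :
  (forall u v, f u = f v -> h u = h v) ->
  \sum_(i < n) distinct f (fun v => P v && (h v == i)) <= distinct f P.
Proof.
move=> fh.
suff: \sum_(i < n) distinct f (fun v => P v && (h v == i))
    <= distinct f (fun v => P v && (h v < n)).
  by move/leq_trans; apply; apply: distinctS => v /andP[].
elim: n => [|n IHn]; first by rewrite big_ord0.
rewrite big_ord_recr /=; apply: leq_trans (leq_add IHn (leqnn _)) _.
apply: distinct_disjoint => //.
  move=> u v /andP[_ un] /andP[_ /eqP vn]; apply: contraTneq un => /fh ->.
  by rewrite vn ltnn.
by move=> v /orP[/andP[-> vn]|/andP[-> /eqP->]] //=; apply: ltnW.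
Qed.

End Distinct.

(** This monotone map numbers the members of a duplicate-free [s] from 0 upwards, turning a
    selection of rows or columns into a division into intervals. *)
Definition rank_in (s : seq nat) (x : nat) : nat := count (fun b => b < x) s.

Lemma rank_in_homo s : {homo rank_in s : x y / x <= y}.
Proof. by move=> x y xy; apply: sub_count => b /= bx; apply: leq_trans bx xy. Qed.

Lemma rank_in_onto (s : seq nat) i :
  uniq s -> i < size s -> exists2 b, b \in s & rank_in s b = i.
Proof.
move=> us si; pose t := sort leq s.
have st : size t = size s by rewrite size_sort.
exists (nth 0 t i); first by rewrite -(mem_sort leq) mem_nth // st.
rewrite /rank_in -(seq.permP (permEl (perm_sort leq s))) -/t.
have lt_t : sorted ltn t.
  by rewrite ltn_sorted_uniq_leq sort_uniq us sort_sorted //; apply: leq_total.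
rewrite -[t in count _ t](cat_take_drop i) count_cat.
have -> : count (fun b => b < nth 0 t i) (take i t) = i.
  rewrite -[RHS](@size_takel i _ t) ?st ?(ltnW si) //; apply/eqP; rewrite -all_count.
  apply/(all_nthP 0) => j; rewrite size_takel ?st ?(ltnW si) // => ji.
  rewrite nth_take //; apply: (sorted_ltn_nth ltn_trans) => //; rewrite inE st //.
  exact: ltn_trans ji si.
rewrite -[RHS]addn0; congr (_ + _); apply/eqP; rewrite -leqn0 leqNgt -has_count.
apply/hasPn => b /(nthP 0)[j]; rewrite size_drop st nth_drop => js <-.
rewrite -leqNgt; apply: (sorted_leq_nth leq_trans leqnn) => //; rewrite ?inE ?st ?leq_addr //.
  by move: lt_t; rewrite ltn_sorted_uniq_leq => /andP[].
by lia.
Qed.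

Section Grid.
Variable V : finType.
Implicit Types (x y : V -> nat) (P : pred V).

(** The points [(x v, y v)] stand for the ones of a 0/1 matrix. Level sets of monotone maps are
    intervals, so rows and columns are divided such that the first [K] by [K] blocks are all
    nonempty. *)
Definition has_grid K x y P : Prop :=
  exists rho gamma : nat -> nat,
    [/\ {homo rho : i j / i <= j}, {homo gamma : i j / i <= j} &
     forall i j, i < K -> j < K ->
       exists v, [/\ P v, rho (x v) = i & gamma (y v) = j]].

Lemma has_grid_comp K x y P (phi psi : nat -> nat) :
  {homo phi : i j / i <= j} -> {homo psi : i j / i <= j} ->
  has_grid K (phi \o x) (psi \o y) P -> has_grid K x y P.
Proof.
move=> hp hq [rho [gamma [hr hg gr]]]; exists (rho \o phi), (gamma \o psi).
by split=> [i j /hp/hr|i j /hq/hg|].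
Qed.

Lemma has_grid_swap K x y P : has_grid K x y P -> has_grid K y x P.
Proof.
move=> [rho [gamma [hr hg gr]]]; exists gamma, rho; split=> // i j iK jK.
by have [v []] := gr j i jK iK; exists v.
Qed.

Definition block S x y (v : V) := (x v %/ S, y v %/ S).

(** Among more than [K * 2 ^ S] wide blocks with the same [y %/ S], more than [K] occupy the same
    set of columns, and these contain a grid. Each block has at most [S * S] cells. *)
Lemma wide_blocks_bound K S n x y P :
  0 < K -> 0 < S -> ~ has_grid K x y P ->
  (forall v, P v -> y v %/ S < n) ->
  distinct (fun v => (x v, y v))
    (fun v => P v && (K <= distinct y (fun u => P u && (block S x y u == block S x y v))))
  <= S * S * (K * 2 ^ S) * n.
Proof.
move=> K0 S0 noK yn; set blk := block S x y.
have modS j : j %% S < S by rewrite ltn_mod.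
apply: leq_trans (distinct_mul (g := fun v => y v %/ S) (m := S * S * (K * 2 ^ S)) _) _; last first.
  rewrite leq_mul2l; apply/orP; right; apply: (@distinct_range _ _ _ 0) => v /andP[/yn].
  by rewrite add0n.
move=> v0 _.
apply: leq_trans (distinct_mul (g := fun v => x v %/ S) (m := S * S) _) _.
  move=> v1 Qv1; apply: leq_trans (distinct_pair _ _ _) _; apply: leq_mul.
    apply: (@distinct_range _ _ _ (x v1 %/ S * S)) => v /andP[_ /eqP <-].
    by rewrite leq_divM -mulSnr ltn_ceil.
  apply: (@distinct_range _ _ _ (y v1 %/ S * S)) => v /andP[/andP[_ /eqP E] _].
  have /eqP <- : y v %/ S == y v1 %/ S by case/andP: Qv1 => _ /eqP ->; rewrite E.
  by rewrite leq_divM -mulSnr ltn_ceil.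
rewrite leq_mul2l; apply/orP; right.
pose cols v := [set j : 'I_S | [exists u, [&& P u, blk u == blk v & y u %% S == j]]].
apply: leq_trans (distinct_mul (g := cols) (m := K) _) _; last first.
  rewrite leq_mul2l; apply/orP; right; apply: leq_trans (distinct_card _ _) _.
  by rewrite -cardsT -powersetT card_powerset cardsT card_ord.
move=> v1 /andP[/andP[Pv1 wv1] /eqP yv1]; rewrite leqNgt; apply/negP => big; apply: noK.
set Q' := (X in distinct _ X) in big.
pose B := undup [seq x v %/ S | v <- enum Q'].
pose Y := undup [seq y v | v <- enum (fun u => P u && (blk u == blk v1))].
exists (fun i => rank_in B (i %/ S)), (rank_in Y); split.
- by move=> i j ij; apply/rank_in_homo/leq_div2r.
- exact: rank_in_homo.
move=> i j iK jK.
have [|alpha /mem_distinct[v Qv ->] ri] := @rank_in_onto B i (undup_uniq _).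
  exact: ltn_trans iK big.
have [|y0 /mem_distinct[u /andP[Pu /eqP bu] ->] rj] := @rank_in_onto Y j (undup_uniq _).
  exact: leq_trans jK wv1.
have /andP[/andP[_ /eqP yv] /eqP colv] := Qv.
have : Ordinal (modS (y u)) \in cols v1.
  by rewrite inE; apply/existsP; exists u; rewrite Pu bu !eqxx.
rewrite -colv inE => /existsP[w /and3P[Pw /eqP[xw yw] /eqP mw]].
exists w; split=> //; first by rewrite xw.
have [_ yu] := bu.
by rewrite (divn_eq (y w) S) yw yv -yv1 -yu mw -divn_eq.
Qed.

End Grid.

(** Cut into blocks of side [S]. A block neither wide nor tall has at most [K * K] cells, and the
    induction hypothesis bounds the number of nonempty blocks; wide and tall blocks are counted
    directly. *)
Theorem marcus_tardos K : exists c, forall (V : finType) (x y : V -> nat) (P : pred V) n,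
  (forall v, P v -> x v < n /\ y v < n) -> ~ has_grid K x y P ->
  distinct (fun v => (x v, y v)) P <= c * n.
Proof.
case: (posnP K) => [->|K0].
  by exists 0 => V x y P n _ []; exists id, id; split.
(* As [S * n' <= 2 * n] below, this [S] makes the thin cells at most half of the bound. The term
   [8 * Z] makes wide and tall cells together at most a quarter, and the summand [S] covers
   [n < S]. *)
pose S := 4 * (K * K); pose Z := S * S * (K * 2 ^ S).
exists (8 * Z + S) => V x y P n; have [N] := ubnP n.
elim: N => // N IHN in x y P n * => nN bd noK.
case: (leqP S n) => Sn; last first.
  apply: leq_trans (distinct_pair _ _ _) _; apply: leq_mul.
    apply: (@distinct_range _ _ _ 0) => v /bd[]; lia.
  by apply: (@distinct_range _ _ _ 0) => v /bd[].
have S4 : 4 <= S by rewrite /S; move: K0; clear; nia.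
have S0 : 0 < S by lia.
pose n' := (n %/ S).+1; pose blk := block S x y.
have n'n : n' < n.
  rewrite /n'; have := leq_div2l n (isT : 0 < 4) S4; have := leq_divM n 4; lia.
have Sn' : S * n' <= 2 * n.
  by rewrite /n' mulnS; have := leq_divM n S; rewrite mulnC; lia.
have bd' v : P v -> x v %/ S < n' /\ y v %/ S < n'.
  by move/bd=> [xv yv]; rewrite !ltnS !leq_div2r // ltnW.
pose wide v := P v && (K <= distinct y (fun u => P u && (blk u == blk v))).
pose tall v := P v && (K <= distinct x (fun u => P u && (blk u == blk v))).
pose thin v := [&& P v, ~~ wide v & ~~ tall v].
have thinB : distinct (fun v => (x v, y v)) thin <= K * K * ((8 * Z + S) * n').
  apply: leq_trans (distinct_mul (g := blk) (m := K * K) _) _.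
    move=> v0 /and3P[Pv0]; rewrite /wide /tall Pv0 /= -!ltnNge => wv tv.
    apply: leq_trans (distinct_pair _ _ _) _; apply: leq_mul; apply: ltnW.
      apply: leq_ltn_trans tv; apply: distinctS => v /andP[/and3P[vP _ _] vb].
      by apply/andP.
    apply: leq_ltn_trans wv; apply: distinctS => v /andP[/and3P[vP _ _] vb].
    by apply/andP.
  rewrite leq_mul2l; apply/orP; right.
  apply: leq_trans (IHN (fun v => x v %/ S) (fun v => y v %/ S) P n' _ bd' _).
  - by apply: distinctS => v /andP[].
  - lia.
  - move=> g; apply: noK.
    by apply: (@has_grid_comp _ K x y P (divn^~ S) (divn^~ S)) g => i j ij;
      apply: leq_div2r.
have wideB : distinct (fun v => (x v, y v)) wide <= Z * n'.
  by apply: wide_blocks_bound => // v /bd'[].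
have tallB : distinct (fun v => (x v, y v)) tall <= Z * n'.
  apply: leq_trans (_ : distinct (fun v => (y v, x v)) tall <= _).
    by apply: distinct_factor => u v _ _ [-> ->].
  apply: leq_trans (wide_blocks_bound K0 S0 (fun g => noK (has_grid_swap g))
    (fun v Pv => (bd' v Pv).1)).
  apply: distinctS => v /andP[Pv tv]; apply/andP; split=> //.
  apply: leq_trans tv _; apply: distinctS => u /andP[Pu /eqP[E1 E2]].
  by apply/andP; split=> //; rewrite /block E1 E2.
have : distinct (fun v => (x v, y v)) P <=
    K * K * ((8 * Z + S) * n') + (Z * n' + Z * n').
  pose xy v := (x v, y v).
  have s1 : distinct xy P <= distinct xy thin + distinct xy (fun v => wide v || tall v).
    apply: distinctU => v Pv; rewrite /thin Pv /=.
    by case: (wide v); case: (tall v).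
  have s2 : distinct xy (fun v => wide v || tall v) <= distinct xy wide + distinct xy tall.
    exact: distinctU.
  apply: leq_trans s1 _; apply: leq_add => //; apply: leq_trans s2 _; exact: leq_add.
move/leq_trans; apply.
have E1 : 2 * (K * K * ((8 * Z + S) * n')) <= (8 * Z + S) * n.
  rewrite -(leq_pmul2l (isT : 0 < 2)).
  apply: leq_trans (_ : (8 * Z + S) * (S * n') <= _).
    by rewrite /S; clear; nia.
  by rewrite [leqRHS]mulnCA leq_mul2l Sn' orbT.
have E2 : Z * n' <= Z * n by rewrite leq_mul2l ltnW ?orbT.
have : 8 * Z * n <= (8 * Z + S) * n by rewrite leq_mul2r leq_addr orbT.
move: E1 E2; clear; lia.
Qed.

(** * Contraction along a line *)

Definition width_at_most B (T : trigraph) : Prop :=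
  exists s : contraction_sequence T, width s <= B.

(** * From a partition to a coarser one *)

Section Merging.
Variables (G : sgraph) (K0 K1 : eqType) (k0 : G -> K0) (k1 : G -> K1).
Variables (mixed : rel G) (B : nat).
Hypothesis mixed_inv : forall u u' v v',
  k1 u = k1 u' -> k1 v = k1 v' -> mixed u v = mixed u' v'.
Hypothesis homogeneous : forall u u' v v', k1 u = k1 u' -> k1 v = k1 v' ->
  k1 u <> k1 v -> ~~ mixed u v -> adj u v = adj u' v'.
Hypothesis few : forall u, distinct k0 (fun v => (k1 v == k1 u) || mixed u v) <= B.

(** A red neighbour of the part of [u] contains a vertex in the [k1]-class of [u] or mixed with [u].
    Parts are unions of [k0]-classes, so distinct red neighbours use distinct classes counted in
    [few]. *)
Lemma max_red_degree_between (T : trigraph) (q : G -> T) :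
  represents q -> (forall u v, k0 u = k0 v -> q u = q v) ->
  (forall u v, q u = q v -> k1 u = k1 v) -> max_red_degree T <= B.
Proof.
case=> qS _ qR q0 q1; apply/bigmax_leqP => x _; have [u <-] := qS x.
apply: leq_trans (few u); apply: leq_trans (distinct_factor (f := q) _); last first.
  by move=> ? ? _ _ /q0.
rewrite cardE; apply: uniq_leq_size (enum_uniq _) _ => y.
rewrite mem_enum inE => /qR[_ [u1 [v1 [qu1 qv1 ad]]] [u2 [v2 [qu2 qv2 nad]]]].
apply/mem_distinct; exists v1 => //.
case: eqP => //= ne; apply: contraNT nad => nm.
rewrite -(homogeneous (u := u1) (v := v1)) //.
- by apply: q1; rewrite qu1 qu2.
- by apply: q1; rewrite qv1 qv2.
- by move=> E; apply: ne; rewrite -E; apply: q1.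
- by rewrite (mixed_inv (u' := u) (v' := v1)) //; apply: q1.
Qed.

(** Inside the [k1]-classes any order of contraction works, as all intermediate partitions obey the
    same degree bound; [final] takes over once these classes are reached. *)
Lemma contract_until (T : trigraph) (q : G -> T) :
  represents q -> (forall u v, k0 u = k0 v -> q u = q v) ->
  (forall u v, q u = q v -> k1 u = k1 v) ->
  (forall (T' : trigraph) (q' : G -> T'), represents q' ->
    (forall u v, q' u = q' v <-> k1 u = k1 v) -> width_at_most B T') ->
  width_at_most B T.
Proof.
move=> rq q0 q1 final; have [n] := ubnP #|T|.
elim: n => // n IHn in T q rq q0 q1 * => Tn.
have [same|] := pselect (forall u v, k1 u = k1 v -> q u = q v).
  by apply: (final _ q) => // u v; split; [apply: q1|apply: same].
move/existsNP=> [u /existsNP[v /not_implyP[kuv /eqP quv]]].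
have [||||s sB] := IHn (contract (q u) (q v)) (contract_map (q u) (q v) \o q).
- exact: represents_contract.
- by move=> a b /q0 /= ->.
- move=> a b /=.
  case: (contract_mapP (q u) (q v) (q a)) => [[z -> zE] /esym/contract_map_Some E|[-> aE]].
    by apply: q1; rewrite E.
  move/esym/contract_map_None => bE.
  have -> : k1 a = k1 u by case: aE => /q1 ->.
  by case: bE => /q1 ->.
- by rewrite -ltnS -card_contract // (leq_trans Tn).
exists (contraction_step quv s); rewrite /= geq_max sB andbT.
exact: (max_red_degree_between rq).
Qed.

End Merging.

(** Averaging: the [s - 1] pairs sum to at most [2 * A * s <= 4 * A * (s - 1)], as [s >= 2]. *)
Lemma light_consecutive_pair (f : nat -> nat) s A :
  1 < s -> \sum_(i < s) f i <= A * s ->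
  exists2 i, i.+1 < s & f i + f i.+1 <= 4 * A.
Proof.
case: s => [|[|s]] // _ fA; apply: contrapT => no.
have: \sum_(i < s.+1) (4 * A).+1 <= \sum_(i < s.+1) (f i + f i.+1).
  apply: leq_sum => i _; rewrite ltnNge; apply/negP => le; apply: no.
  by exists i; rewrite // ltnS.
rewrite big_split /= sum_nat_const card_ord.
have E1 := @big_ord_recr _ 0 addn s.+1 (fun i : 'I_s.+2 => f i).
have E2 := @big_ord_recl _ 0 addn s.+1 (fun i : 'I_s.+2 => f i).
move: fA; rewrite /= in E1 E2.
set S := \sum_(i < s.+2) f i in E1 E2 *.
set S1 := \sum_(i < s.+1) f i in E1 *.
have -> : \sum_(i < s.+1) f i.+1 = \sum_(i < s.+1) f (lift ord0 i) by [].
move: E1 E2; set S2 := \sum_(i < s.+1) f _; clear; nia.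
Qed.

(** * Merging consecutive parts of the line *)

Section LineContraction.
Variables (G : sgraph) (D : finType) (tau : G -> D) (flip : rel D).
Variables (pl pr : G -> nat).
Hypothesis pl_inj : injective pl.
Hypothesis pr_inj : injective pr.
Hypothesis adjE : forall u v : G, u != v ->
  adj u v = ((pl u < pr v) && (pl v < pr u)) (+) flip (tau u) (tau v).

(** [phi] divides the line into its level sets; the values of [key phi] are the nonempty cells,
    which serve as parts of the vertex partition. *)
Definition key (phi : nat -> nat) (v : G) := (phi (pl v), phi (pr v), tau v).
Definition touches (phi : nat -> nat) i (v : G) :=
  (phi (pl v) == i) || (phi (pr v) == i).

Lemma homo_ltE (phi : nat -> nat) x y :
  {homo phi : i j / i <= j} -> phi x != phi y -> (x < y) = (phi x < phi y).
Proof.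
move=> hp ne; case: (ltnP x y) => [/ltnW/hp|/hp]; first by rewrite ltn_neqAle ne => ->.
by rewrite leqNgt => /negbTE.
Qed.

Variables (K c : nat).
Hypothesis no_grid : forall t, ~ has_grid K pl pr (fun v => tau v == t).
Hypothesis cP : forall (V : finType) (x y : V -> nat) (P : pred V) n,
  (forall v, P v -> x v < n /\ y v < n) -> ~ has_grid K x y P ->
  distinct (fun v => (x v, y v)) P <= c * n.

(** The first term bounds the load of a freshly merged part, the summand [2] the load of a single
    position. In [B], [2 * d] counts the cells touching the part of either end of a vertex, and
    [#|D|] the cells once a single part of the line remains. *)
Let d := 8 * (c * #|D|) + 2.
Let B := 2 * d + #|D|.

Lemma line_contraction s (phi : nat -> nat) (T : trigraph) (q : G -> T) :
  {homo phi : i j / i <= j} ->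
  (forall v, phi (pl v) < s /\ phi (pr v) < s) ->
  (forall i, distinct (key phi) (touches phi i) <= d) ->
  represents q -> (forall u v, q u = q v <-> key phi u = key phi v) ->
  width_at_most B T.
Proof.
elim: s phi T q => [|s IHs] phi T q hp bd load rq qk.
  have T1 : #|T| <= 1.
    rewrite leqNgt; apply/negP => /card_gt1P[x _].
    by case: rq => /(_ x)[u _] _ _; have [] := bd u.
  exists (contraction_done T1); apply/bigmax_leqP => x _ /=.
  by rewrite (leq_trans (max_card _)) // (leq_trans T1) // /B /d; lia.
case: s IHs bd => [_ bd|s IHs bd].
  apply: (@contract_until G _ _ (key phi) (fun=> tt) (fun _ _ => false) _ _ _ _ _ q) => //.
  - move=> u; apply: leq_trans (_ : #|D| <= _); last by rewrite /B leq_addl.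
    apply: leq_trans (distinct_card tau _); apply: distinct_factor => a b _ _ E.
    have [a1 a2] := bd a; have [b1 b2] := bd b.
    rewrite /key E; congr (_, _, _); lia.
  - by move=> u v /qk.
  move=> T' q' [qS _ _] q1.
  have T1 : #|T'| <= 1.
    apply/fintype_le1P => x y; have [u <-] := qS x; have [v <-] := qS y.
    exact/q1.
  exists (contraction_done T1); apply/bigmax_leqP => x _ /=.
  by rewrite (leq_trans (max_card _)) // (leq_trans T1) // /B /d; lia.
have total : distinct (key phi) predT <= c * #|D| * s.+2.
  apply: leq_trans (distinct_mul (g := tau) (m := c * s.+2) _) _.
    move=> v0 _; apply: leq_trans (cP (x := phi \o pl) (y := phi \o pr)
      (P := fun v => tau v == tau v0) (n := s.+2) _ _).
    - apply: leq_trans (distinct_factor (g := fun v => (phi (pl v), phi (pr v))) _) _.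
        by move=> a b /andP[_ /eqP E1] /andP[_ /eqP E2] [E3 E4]; rewrite /key E3 E4 E1 E2.
      exact: distinctS.
    - by move=> v _; apply: bd.
    - by move/(has_grid_comp hp hp); apply: no_grid.
  by rewrite [leqRHS]mulnAC leq_mul2l distinct_card orbT.
(* A cell touches at most two parts, one per end, so the loads sum to at most twice the number of
   cells. *)
have [||i is_ fi] := @light_consecutive_pair
    (fun i => distinct (key phi) (touches phi i)) s.+2 (2 * (c * #|D|)).
- by [].
- apply: leq_trans (_ : _ <= \sum_(i < s.+2)
      (distinct (key phi) (fun v => predT v && (phi (pl v) == i)) +
       distinct (key phi) (fun v => predT v && (phi (pr v) == i)))) _.
    by apply: leq_sum => i _; apply: distinctU => v.
  rewrite big_split /= -mulnA mul2n -addnn; apply: leq_add.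
    by apply: leq_trans total; apply: sum_distinct_fibers => u v [].
  by apply: leq_trans total; apply: sum_distinct_fibers => u v [].
pose psi x := if x <= i then x else x.-1.
have psiP x : (x <= i /\ psi x = x) \/ (i < x /\ psi x = x.-1).
  by rewrite /psi; case: leqP; [left|right].
pose phi' x := psi (phi x).
have hp' : {homo phi' : i j / i <= j}.
  by move=> a b /hp; rewrite /phi'; have := psiP (phi a); have := psiP (phi b); lia.
have keyS u v : key phi u = key phi v -> key phi' u = key phi' v.
  by rewrite /key /phi' /= => -[-> -> ->].
have load' j : distinct (key phi) (touches phi' j) <= d.
  case: (ltngtP j i) => [ji|ji|->].
  - apply: leq_trans (load j); apply: distinctS => v; rewrite /in_mem /= /touches /phi'.
    have := psiP (phi (pl v)); have := psiP (phi (pr v)); lia.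
  - apply: leq_trans (load j.+1); apply: distinctS => v; rewrite /in_mem /= /touches /phi'.
    have := psiP (phi (pl v)); have := psiP (phi (pr v)); lia.
  - apply: leq_trans (_ : 4 * (2 * (c * #|D|)) <= _); last by rewrite /d; lia.
    apply: leq_trans fi; apply: distinctU => v; rewrite /touches /phi'.
    have := psiP (phi (pl v)); have := psiP (phi (pr v)); lia.
(* If the left end of each vertex avoids the part of the other's right end, the parts decide both
   comparisons. *)
pose mixed u v := (phi' (pl u) == phi' (pr v)) || (phi' (pl v) == phi' (pr u)).
apply: (@contract_until G _ _ (key phi) (key phi') mixed _ _ _ _ _ q) => //.
- by move=> u u' v v'; rewrite /mixed => -[-> -> _] [-> -> _].
- move=> u u' v v' ku kv kuv; rewrite /mixed negb_or => /andP[m1 m2].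
  have uv : u != v by apply: contra_notN kuv => /eqP->.
  have u'v' : u' != v' by apply: contra_notN kuv; rewrite ku kv => /eqP->.
  rewrite !adjE //; case: ku kv => l1 r1 t1 [l2 r2 t2].
  rewrite (homo_ltE hp' m1) (homo_ltE hp' m2) t1 t2.
  rewrite l1 r2 in m1 *; rewrite l2 r1 in m2 *.
  by rewrite -(homo_ltE hp' m1) -(homo_ltE hp' m2).
- move=> u; apply: leq_trans (_ : d + d <= _); last by rewrite /B; lia.
  apply: leq_trans (leq_add (load' (phi' (pl u))) (load' (phi' (pr u)))).
  apply: distinctU => v; rewrite /touches /mixed => /orP[/eqP[-> _ _]|/orP[/eqP->|->]].
  + by rewrite eqxx.
  + by rewrite eqxx orbT.
  + by rewrite orbT.
- by move=> u v /qk.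
- by move=> u v /qk/keyS.
move=> T' q' rq' q'k; apply: (IHs phi' T' q') => //.
- move=> v; have := bd v; rewrite /phi'.
  have := psiP (phi (pl v)); have := psiP (phi (pr v)); lia.
- by move=> j; apply: leq_trans (load' j); apply: distinct_factor => u v _ _ /keyS.
Qed.

Lemma no_grid_twin_width : twin_width G <= B.
Proof.
have [s sB] : width_at_most B (trigraph_of G); last exact: twin_width_le sB.
pose N := \max_(v : G) (pl v + pr v).
apply: (@line_contraction N.+1 id (trigraph_of G) id) => //.
- move=> v; have := @leq_bigmax _ (fun v : G => pl v + pr v) v; rewrite -/N.
  by move=> vN; rewrite !ltnS; split; apply: leq_trans vN; rewrite ?leq_addr ?leq_addl.
- move=> i; apply: leq_trans (_ : 1 + 1 <= _); last by rewrite /d; lia.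
  have U : distinct (key id) (touches id i) <=
      distinct (key id) (fun v => pl v == i) + distinct (key id) (fun v => pr v == i).
    exact: distinctU.
  apply: leq_trans U _.
  apply: leq_add; apply: leq_trans (distinct_factor (g := fun=> tt) _) _.
  + by move=> u v /eqP uE /eqP vE _; have /pl_inj -> : pl u = pl v by rewrite uE.
  + by apply: leq_trans (distinct_card _ _) _; rewrite card_unit.
  + by move=> u v /eqP uE /eqP vE _; have /pr_inj -> : pr u = pr v by rewrite uE.
  + by apply: leq_trans (distinct_card _ _) _; rewrite card_unit.
- exact: represents_id.
- by move=> u v; split=> [->|[/pl_inj]].
Qed.

End LineContraction.

(** * Interval graphs *)

Lemma interval_convex (R : realType) (J : interval R) (x y z : R) :
  x \in J -> z \in J -> (x <= y)%R -> (y <= z)%R -> y \in J.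
Proof.
case: J => l u; rewrite !itv_boundlr => /andP[lx _] /andP[_ zu] xy yz.
apply/andP; split.
  by apply: Order.POrderTheory.le_trans lx _; rewrite leBSide.
by apply: Order.POrderTheory.le_trans _ zu; rewrite leBSide.
Qed.

(** One sample point from each nonempty intersection decides adjacency. Counting sample points gives
    integer ends, whatever the kind of intervals. *)
Lemma interval_graph_nat (R : realType) (G : sgraph) : interval_graph R G ->
  exists a b : G -> nat, (forall v, a v <= b v) /\
    forall u v, u != v -> adj u v = (a u <= b v) && (a v <= b u).
Proof.
case=> J JP.
have /choice [pt ptP] : forall uv : G * G, exists x : R,
    (exists y, y \in J uv.1 /\ y \in J uv.2) -> x \in J uv.1 /\ x \in J uv.2.
  move=> uv; have [[y yP]|no] := pselect (exists y, y \in J uv.1 /\ y \in J uv.2).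
    by exists y.
  by exists 0%R.
pose before z v := `[< forall y, y \in J v -> (pt z < y)%R >].
pose after z v := `[< forall y, y \in J v -> (y < pt z)%R >].
have beforePn z v : ~~ before z v <-> exists2 y, y \in J v & (y <= pt z)%R.
  split=> [/asboolPn/existsNP[y /not_implyP[yJ /negP]]|[y yJ yz]].
    by rewrite -Order.TotalTheory.leNgt; exists y.
  by apply/asboolPn => /(_ y yJ); rewrite Order.TotalTheory.ltNge yz.
have afterPn z v : ~~ after z v <-> exists2 y, y \in J v & (pt z <= y)%R.
  split=> [/asboolPn/existsNP[y /not_implyP[yJ /negP]]|[y yJ yz]].
    by rewrite -Order.TotalTheory.leNgt; exists y.
  by apply/asboolPn => /(_ y yJ); rewrite Order.TotalTheory.ltNge yz.
pose a0 v := #|[set z | before z v]|; pose b0 v := #|[set z | ~~ after z v]|.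
(* The sample points before one interval and those not after another are both initial segments, so
   comparing sizes amounts to comparing the sets. *)
have ab u v : a0 u < b0 v <-> exists z, ~~ before z u /\ ~~ after z v.
  split=> [lt|[z [zu zv]]].
    apply: contrapT => no; move: lt; rewrite ltnNge => /negP; apply.
    apply/subset_leq_card/subsetP => z; rewrite !inE => zv.
    by apply: contrapT => /negP zu; apply: no; exists z.
  apply: proper_card; apply/properP; split; last by exists z; rewrite inE.
  apply/subsetP => z'; rewrite !inE => /asboolP z'u; apply/afterPn.
  have /beforePn[y yJ yz] := zu; have /afterPn[y' y'J zy'] := zv.
  exists y' => //; apply: Order.POrderTheory.ltW.
  apply: Order.POrderTheory.lt_le_trans (z'u y yJ) _.
  exact: Order.POrderTheory.le_trans yz zy'.
have adj0 u v : u != v -> adj u v = (a0 u < b0 v) && (a0 v < b0 u).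
  move=> uv; apply/idP/andP => [/(JP _ _ uv)|[/ab[z [/beforePn[y yu yz] /afterPn[y' y'v zy']]]]].
    move=> /(ptP (u, v))/= [pu pv].
    by split; apply/ab; exists (u, v); split; [apply/beforePn|apply/afterPn
      |apply/beforePn|apply/afterPn]; exists (pt (u, v)).
  move=> /ab[t [/beforePn[x' x'v x't] /afterPn[x xu tx]]]; apply/(JP _ _ uv).
  have yy' := Order.POrderTheory.le_trans yz zy'.
  have x'x := Order.POrderTheory.le_trans x't tx.
  have [y'x|/Order.POrderTheory.ltW xy'] := Order.TotalTheory.leP y' x.
    by exists y'; split=> //; apply: interval_convex yu xu yy' y'x.
  by exists x; split=> //; apply: interval_convex x'v y'v x'x xy'.
pose N := #|{: G * G}|.
pose ne v := `[< exists x, x \in J v >].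
have bN v : b0 v <= N by apply: max_card.
have a0b0 v : ne v -> a0 v < b0 v.
  move=> /asboolP[x xv]; apply/ab; exists (v, v).
  have [pv _] : pt (v, v) \in J v /\ pt (v, v) \in J v by apply: (ptP (v, v)); exists x.
  by split; [apply/beforePn|apply/afterPn]; exists (pt (v, v)).
have empty u v : ~~ ne u -> (a0 u < b0 v) = false /\ (a0 v < b0 u) = false.
  move=> nu; have no y : y \in J u -> False.
    by move=> yu; move/negP: nu; apply; apply/asboolP; exists y.
  split; apply/negP => /ab[z].
    by case=> /beforePn[y /no].
  by case=> _ /afterPn[y /no].
(* Subtracting 1 turns the strict comparison into a weak one. A vertex with empty interval becomes a
   private point from [N] on, hence isolated. *)
exists (fun v => if ne v then a0 v else N + enum_rank v),
  (fun v => if ne v then (b0 v).-1 else N + enum_rank v).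
split=> [v|u v uv]; first by case: (boolP (ne v)) => // /a0b0; lia.
rewrite adj0 //.
have rk : enum_rank u != enum_rank v :> nat.
  by apply: contra uv => /eqP/val_inj/enum_rank_inj ->.
have bu := bN u; have bv := bN v.
case: (boolP (ne u)) => [neu|/(empty _ v)[-> ->]];
  case: (boolP (ne v)) => [nev|/(empty _ u)[E1 E2]].
- have := a0b0 _ neu; have := a0b0 _ nev; lia.
- rewrite E1 E2; have := a0b0 _ neu; lia.
- have := a0b0 _ nev; lia.
- lia.
Qed.

(** * Normalizing the ends of intervals *)

Section Tighten.
Variables (V : finType) (a b : V -> nat).

(* Push every left end down to just above the nearest right end below it, then
   every right end down to the nearest new left end *)
Definition tight_left u := \max_(x | b x < a u) (b x).+1.
Definition tight_right u := \max_(y | tight_left y <= b u) tight_left y.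

(** No right end lies from the new left end up to just below the old one, so no comparison
    changes. *)
Lemma tight_left_le u v : (tight_left u <= b v) = (a u <= b v).
Proof.
apply/idP/idP => [|auv].
  apply: contraTT; rewrite -!ltnNge => lt.
  exact: (@leq_bigmax_cond _ (fun x => b x < a u) (fun x => (b x).+1) v).
apply/bigmax_leqP => x xu; exact: leq_trans xu auv.
Qed.

Lemma tight_leq u v : (tight_left u <= tight_right v) = (a u <= b v).
Proof.
rewrite -tight_left_le; apply/idP/idP => [uv|uv].
  apply: leq_trans uv _; apply/bigmax_leqP => y; exact.
exact: (@leq_bigmax_cond _ (fun y => tight_left y <= b v)).
Qed.

Lemma bigmax_attained (P : pred V) (F : V -> nat) :
  0 < \max_(x | P x) F x -> exists2 x, P x & \max_(x | P x) F x = F x.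
Proof.
move=> pos; apply: contrapT => no.
suff : \max_(x | P x) F x <= (\max_(x | P x) F x).-1 by lia.
apply/bigmax_leqP => x Px.
have := @leq_bigmax_cond _ P F x Px; case: (ltngtP (F x) (\max_(x | P x) F x)) => //.
  by move=> ? _; lia.
by move=> E; case: no; exists x.
Qed.

(** A positive tightened left end is the successor of some [b x], and this [x] separates. *)
Lemma tight_left_sep u v : tight_left u < tight_left v ->
  exists x, tight_left u <= tight_right x < tight_left v.
Proof.
move=> uv; have [|x xv E] := @bigmax_attained (fun x => b x < a v) (fun x => (b x).+1).
  exact: leq_ltn_trans uv.
exists x; have ux : tight_left u <= b x by rewrite -ltnS -E.
rewrite tight_leq -tight_left_le ux /= /tight_left E ltnS.
by apply/bigmax_leqP => y; exact.
Qed.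

Lemma tight_right_sep u v : tight_right u < tight_right v ->
  exists y, tight_right u < tight_left y <= tight_right v.
Proof.
move=> uv; have [|y yv E] := @bigmax_attained (fun y => tight_left y <= b v) tight_left.
  exact: leq_ltn_trans uv.
by exists y; rewrite -E uv /=.
Qed.

End Tighten.


Lemma lex_lt D x x' y y' :
  x < D -> x' < D -> (y * D + x < y' * D + x') = (y < y') || ((y == y') && (x < x')).
Proof.
move=> xD x'D; case: (ltngtP y y') => [lt|lt|->] /=; last by rewrite ltn_add2l.
  have := leq_mul lt (leqnn D); rewrite mulSn; lia.
have := leq_mul lt (leqnn D); rewrite mulSn; lia.
Qed.

(* Endpoints on one line: left (right) ends with equal [a] ([b]) are ordered by
   the other end, so that intervals sharing an end are never nested. *)
Lemma endpoint_positions (V : finType) (a b : V -> nat) :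
  exists pl pr : V -> nat,
    [/\ injective pl, injective pr,
        forall u v, (pl u < pr v) = (a u <= b v),
        forall u v, (pl u < pl v -> a u <= a v) /\ (pr u < pr v -> b u <= b v) &
        forall u v, (a u = a v -> pl u < pl v -> pr u < pr v) /\
                    (b u = b v -> pr u < pr v -> pl u < pl v)].
Proof.
pose M := (\max_v (a v + b v)).+1; pose n := #|V|.
pose D := M * n.
have aM v : a v < M.
  by rewrite ltnS; apply: leq_trans (leq_addr (b v) _) (@leq_bigmax _ (fun v => a v + b v) v).
have bM v : b v < M.
  by rewrite ltnS; apply: leq_trans (leq_addl (a v) _) (@leq_bigmax _ (fun v => a v + b v) v).
have rn (v : V) : enum_rank v < n by apply: ltn_ord.
have lexD x (v : V) : x < M -> x * n + enum_rank v < D.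
  by move=> xM; have := leq_mul xM (leqnn n); have := rn v; rewrite mulSn /D; lia.
(* Even leading digits for left ends and odd ones for right ends put a left end before a right end
   of equal value. [enum_rank] breaks the last ties. *)
pose pl v := (a v * 2) * D + (b v * n + enum_rank v).
pose pr v := (b v * 2 + 1) * D + (a v * n + enum_rank v).
have plE u v : (pl u < pl v) = (a u < a v) || (a u == a v) &&
    ((b u < b v) || (b u == b v) && (enum_rank u < enum_rank v)).
  by rewrite (@lex_lt D) ?lexD // (@lex_lt n) // ltn_mul2r eqn_mul2r.
have prE u v : (pr u < pr v) = (b u < b v) || (b u == b v) &&
    ((a u < a v) || (a u == a v) && (enum_rank u < enum_rank v)).
  by rewrite (@lex_lt D) ?lexD // (@lex_lt n) // ltn_add2r ltn_mul2r eqn_add2r eqn_mul2r.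
have rank_inj (u v : V) : enum_rank u = enum_rank v :> nat -> u = v.
  by move=> E; apply/enum_rank_inj/val_inj.
exists pl, pr; split.
- move=> u v E; apply: rank_inj; have := plE u v; have := plE v u; rewrite E ltnn; lia.
- move=> u v E; apply: rank_inj; have := prE u v; have := prE v u; rewrite E ltnn; lia.
- by move=> u v; rewrite lex_lt ?lexD //; lia.
- by move=> u v; rewrite plE prE; lia.
- by move=> u v; rewrite plE prE; lia.
Qed.

(** * Perturbations as colourings *)

(** A type records one membership bit per perturbed set; a pair is flipped when an odd number of
    these sets contains both vertices. *)
Lemma perturbation_types r (I H : sgraph) : bounded_perturbation r I H ->
  exists (D : finType) (f : H -> I) (tau : H -> D) (flip : rel D),
    [/\ #|D| <= 2 ^ r, injective f &
        forall u v, u != v ->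
          adj u v = adj (f u) (f v) (+) flip (tau u) (tau v)].
Proof.
elim=> {r I H} [r G|r G X H _ [D [f [tau [flip [Dr finj fadj]]]]]].
  exists unit, id, (fun=> tt), (fun _ _ => false).
  by split=> [|//|u v _]; rewrite ?card_unit ?expn_gt0 ?addbF.
exists (D * bool)%type, f, (fun v => (tau v, (f v : G) \in X)),
  (fun x y => flip x.1 y.1 (+) (x.2 && y.2)).
split=> [|//|u v uv]; first by rewrite card_prod card_bool expnSr leq_mul.
rewrite fadj //= /perturb_adj (inj_eq finj) uv /= -addbA.
by congr (_ (+) _); rewrite addbC.
Qed.

Lemma perturbed_interval_model (R : realType) r (G : sgraph) :
  perturbed_interval_graph R r G ->
  exists (D : finType) (tau : G -> D) (flip : rel D) (a b : G -> nat),
    [/\ #|D| <= 2 ^ r, forall v, a v <= b v &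
        forall u v, u != v ->
          adj u v = ((a u <= b v) && (a v <= b u)) (+) flip (tau u) (tau v)].
Proof.
case=> I [H [/interval_graph_nat[a [b [ab abE]]] /perturbation_types]].
move=> [D [f [tau [flip [Dr finj fadj]]]]] [h [[h' hK h'K] hadj]].
exists D, (tau \o h'), flip, (a \o (f \o h')), (b \o (f \o h')).
split=> // [u|u v uv]; first exact: ab.
have h'uv : h' u != h' v by rewrite (can_eq h'K).
by rewrite -{1}[u]h'K -{1}[v]h'K hadj fadj // abE // (inj_eq finj).
Qed.

(** * From a grid to graphs exposing a permutation *)

(** [eps] marks the complemented columns of a half graph. Of [2 * p] columns some [p] agree, and a
    half graph complemented throughout is again one. *)
Lemma half_graph_selection p (eps : nat -> bool) :
  exists row col : 'I_p -> nat,
    [/\ forall i, row i <= 2 * p, forall k, col k < 2 * p &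
        forall i k, ((row i <= col k) (+) eps (col k)) = (k <= i)].
Proof.
have [e se] : exists e, p <= size [seq k <- iota 0 (2 * p) | eps k == e].
  have : size [seq k <- iota 0 (2 * p) | eps k == true] +
         size [seq k <- iota 0 (2 * p) | eps k == false] = 2 * p.
    rewrite -[RHS](size_iota 0) !size_filter -(count_predC (fun k => eps k == true)).
    by congr (_ + _); apply: eq_count => k /=; case: (eps k).
  by move=> E; case: (leqP p (size [seq k <- iota 0 (2 * p) | eps k == true])) => ?;
    [exists true|exists false; lia].
set s := filter _ _ in se.
have srt : sorted ltn s by apply: (sorted_filter ltn_trans); apply: iota_ltn_sorted.
pose nt i := nth 0 s i.
have ntlt i j : i < p -> j < p -> i < j -> nt i < nt j.
  by move=> ip jp; apply: (sorted_ltn_nth ltn_trans) => //; rewrite inE (leq_trans _ se).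
have ntle i j : i < p -> j < p -> (nt i <= nt j) = (i <= j).
  move=> ip jp; case: (ltngtP i j) => [/(ntlt _ _ ip jp)/ltnW ->//|lt|->]; last exact: leqnn.
  by rewrite leqNgt ntlt.
have ntP i : i < p -> eps (nt i) = e /\ nt i < 2 * p.
  move=> ip; have : nt i \in s by rewrite mem_nth // (leq_trans ip).
  by rewrite mem_filter mem_iota => /andP[/eqP-> ].
have rev_lt (i : 'I_p) : p - i.+1 < p by have := ltn_ord i; lia.
(* Complemented columns are read in increasing order, the successor correcting the strictness; the
   others are read backwards. *)
case: e @s se srt @nt ntlt ntle ntP => s se srt nt ntlt ntle ntP.
  exists (fun i => (nt i).+1), (fun k => nt k); split.
  - by move=> i; have [] := ntP i (ltn_ord i).
  - by move=> k; have [] := ntP k (ltn_ord k).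
  - move=> i k; have [-> _] := ntP k (ltn_ord k).
    by rewrite addbT -leqNgt ntle.
exists (fun i => nt (p - i.+1)), (fun k => nt (p - k.+1)); split.
- by move=> i; have [_ /ltnW] := ntP _ (rev_lt i).
- by move=> k; have [] := ntP _ (rev_lt k).
- move=> i k; have [-> _] := ntP _ (rev_lt k).
  by rewrite addbF ntle //; have := ltn_ord i; have := ltn_ord k; lia.
Qed.

Section InducedSubgraph.
Variables (G : sgraph) (S : {set G}).

Definition sub_adj : rel {v | v \in S} := fun u v => adj (val u) (val v).

Lemma sub_adj_sym : symmetric sub_adj.
Proof. by move=> u v; apply: adj_sym. Qed.

Lemma sub_adj_irrefl : irreflexive sub_adj.
Proof. by move=> u; apply: adj_irrefl. Qed.

Definition subgraph : sgraph := SGraph sub_adj_sym sub_adj_irrefl.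

Lemma subgraph_induced : induced_subgraph subgraph G.
Proof. by exists val; split=> //; apply: val_inj. Qed.
End InducedSubgraph.

(** Members of one family are distinct because their adjacencies have different thresholds. [X j]
    and [Y j] witness that the chains are strict at step [j]. *)
Lemma half_graphs_expose (G : sgraph) p (pi : 'S_p) (w X Y : 'I_p -> G) :
  (forall i k, adj (w i) (X k) = (k <= i)) ->
  (forall i k, adj (w i) (Y k) = (k <= (pi^-1)%g i)) ->
  (forall i k, w i <> X k) -> (forall i k, w i <> Y k) ->
  (forall i k, X i <> Y k) ->
  exists2 H, induced_subgraph H G & exposes pi H.
Proof.
move=> wX wY dX dY dXY.
pose S := [set w i | i : 'I_p] :|: [set X i | i : 'I_p] :|: [set Y i | i : 'I_p].
exists (subgraph S); first exact: subgraph_induced.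
have wS i : w i \in S by rewrite !inE imset_f.
have XS i : X i \in S by rewrite !inE imset_f ?orbT.
have YS i : Y i \in S by rewrite !inE imset_f ?orbT.
pose w' i : subgraph S := exist _ (w i) (wS i).
pose X' i : subgraph S := exist _ (X i) (XS i).
pose Y' i : subgraph S := exist _ (Y i) (YS i).
have eq_leq (i j : 'I_p) : (forall k : 'I_p, (k <= i) = (k <= j)) -> i = j.
  move=> E; apply: val_inj; have := E i; have := E j; rewrite !leqnn /=.
  by move=> ij ji; apply/eqP; rewrite eqn_leq ij -ji.
have eq_geq (i j : 'I_p) : (forall k : 'I_p, (i <= k) = (j <= k)) -> i = j.
  move=> E; apply: val_inj; have := E i; have := E j; rewrite !leqnn /=.
  by move=> ij ji; apply/eqP; rewrite eqn_leq ij -ji.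
have w'inj : injective w'.
  by move=> i j [E]; apply: eq_leq => k; rewrite -!wX E.
have X'inj : injective X'.
  by move=> i j [E]; apply: eq_geq => k; rewrite -!wX E.
have Y'inj : injective Y'.
  move=> i j [E]; apply: eq_geq => k.
  by have := wY (pi k) i; have := wY (pi k) j; rewrite permK E => -> ->.
have wX' i k : adj (w' i) (X' k) = (k <= i) by apply: wX.
have wY' i k : adj (w' i) (Y' k) = (k <= (pi^-1)%g i) by apply: wY.
exists w', [set X' i | i : 'I_p], [set Y' i | i : 'I_p]; split=> //.
- split.
  + apply/setP => -[v vS]; rewrite in_setT !in_setU.
    have : [|| v \in [set w i | i : 'I_p], v \in [set X i | i : 'I_p]
      | v \in [set Y i | i : 'I_p]] by move: vS; rewrite !in_setU orbA.
    move=> /or3P[] /imsetP[i _ E].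
    * rewrite (_ : exist _ v vS = w' i) ?imset_f //; exact: val_inj.
    * rewrite (_ : exist _ v vS = X' i) ?imset_f ?orbT //; exact: val_inj.
    * rewrite (_ : exist _ v vS = Y' i) ?imset_f ?orbT //; exact: val_inj.
  + rewrite disjoint_subset; apply/subsetP => _ /imsetP[i _ ->]; rewrite inE.
    by apply/imsetP => -[k _ [E]]; apply: (dX i k).
  + rewrite disjoint_subset; apply/subsetP => _ /imsetP[i _ ->]; rewrite inE.
    by apply/imsetP => -[k _ [E]]; apply: (dY i k).
  + rewrite disjoint_subset; apply/subsetP => _ /imsetP[i _ ->]; rewrite inE.
    by apply/imsetP => -[k _ [E]]; apply: (dXY i k).
- by rewrite !card_imset // card_ord.
- move=> i; split; apply/set0Pn.
    by exists (X' i); rewrite inE imset_f // wX' leqnn.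
  by exists (Y' ((pi^-1)%g i)); rewrite inE imset_f // wY' leqnn.
move=> i j ij; split; apply/properP; split.
- apply/subsetP => v; rewrite !inE => /andP[/imsetP[k _ ->]].
  by rewrite !wX' imset_f //= => ki; apply: leq_trans ki (ltnW ij).
- by exists (X' j); rewrite inE imset_f // wX' ?leqnn //= -ltnNge.
- apply/subsetP => v; rewrite !inE => /andP[/imsetP[k _ ->]].
  by rewrite !wY' !permK imset_f //= => ki; apply: leq_trans ki (ltnW ij).
- by exists (Y' j); rewrite inE imset_f // wY' permK ?leqnn //= -ltnNge.
Qed.

Section GridExposes.
Variables (G : sgraph) (D : finType) (tau : G -> D) (flip : rel D).
Variables (a b pl pr : G -> nat).
Hypothesis ab : forall v, a v <= b v.
Hypothesis adjE : forall u v, u != v ->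
  adj u v = ((a u <= b v) && (a v <= b u)) (+) flip (tau u) (tau v).
Hypothesis left_sep : forall u v, a u < a v -> exists x, a u <= b x < a v.
Hypothesis right_sep : forall u v, b u < b v -> exists y, b u < a y <= b v.
Hypothesis plr : forall u v, (pl u < pr v) = (a u <= b v).
Hypothesis pl_homo : forall u v, pl u < pl v -> a u <= a v.
Hypothesis pr_homo : forall u v, pr u < pr v -> b u <= b v.
Hypothesis pl_pr : forall u v, a u = a v -> pl u < pl v -> pr u < pr v.
Hypothesis pr_pl : forall u v, b u = b v -> pr u < pr v -> pl u < pl v.

Lemma homo_ltW (f : nat -> nat) x y :
  {homo f : i j / i <= j} -> f x < f y -> x < y.
Proof. by move=> hf; apply: contraTT; rewrite -!leqNgt => /hf. Qed.

(** In a grid the two ends of each [w] can be chosen independently, so both orders are at will.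
    Vertices ending between left ends form [W_1], vertices starting between right ends form
    [W_2]. *)
Lemma grid_exposes p (pi : 'S_p) t :
  has_grid (20 * (2 * p + 2)) pl pr (fun v => tau v == t) ->
  exists2 H, induced_subgraph H G & exposes pi H.
Proof.
set K := 20 * _ => -[rho [gamma [hr hg grid]]].
have K0 : 0 < K by rewrite /K; lia.
have [v00 _] := grid 0 0 K0 K0.
have /choice[v0 v0P] : forall ij : nat * nat, exists v, ij.1 < K -> ij.2 < K ->
    [/\ tau v == t, rho (pl v) = ij.1 & gamma (pr v) = ij.2].
  move=> ij; have [iK|iK] := ltnP ij.1 K; last by exists v00.
  have [jK|jK] := ltnP ij.2 K; last by exists v00.
  by have [v vP] := grid _ _ iK jK; exists v.
pose v i j := v0 (i, j).
have vt i j : i < K -> j < K -> tau (v i j) = t.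
  by move=> iK jK; have [/eqP] := v0P (i, j) iK jK.
have vr i j : i < K -> j < K -> rho (pl (v i j)) = i.
  by move=> iK jK; have [] := v0P (i, j) iK jK.
have vg i j : i < K -> j < K -> gamma (pr (v i j)) = j.
  by move=> iK jK; have [] := v0P (i, j) iK jK.
have lt_pl i i' j j' : i < i' -> i' < K -> j < K -> j' < K -> pl (v i j) < pl (v i' j').
  by move=> *; apply: (homo_ltW hr); rewrite !vr //; lia.
have lt_pr i i' j j' : j < j' -> i < K -> i' < K -> j' < K -> pr (v i j) < pr (v i' j').
  by move=> *; apply: (homo_ltW hg); rewrite !vg //; lia.
(* Different positions may carry the same [a]. Here [v i.+1 1] and [v i.+2 0] would share it, and
   [pl_pr] would order their right ends against the columns 1 and 0. *)
have lt_a i i' j j' : i + 3 <= i' -> i' < K -> j < K -> j' < K -> a (v i j) < a (v i' j').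
  move=> ii' i'K jK j'K; rewrite ltnNge; apply/negP => ge.
  have K1 : 1 < K by lia.
  have l1 : a (v i j) <= a (v i.+1 1) by apply/pl_homo/lt_pl; lia.
  have l12 : pl (v i.+1 1) < pl (v i.+2 0) by apply: lt_pl; lia.
  have l2 := pl_homo l12.
  have l3 : a (v i.+2 0) <= a (v i' j') by apply/pl_homo/lt_pl; lia.
  have E : a (v i.+1 1) = a (v i.+2 0) by lia.
  have := hg _ _ (ltnW (pl_pr E l12)); rewrite !vg //; lia.
have lt_b i i' j j' : j + 3 <= j' -> i < K -> i' < K -> j' < K -> b (v i j) < b (v i' j').
  move=> jj' iK i'K j'K; rewrite ltnNge; apply/negP => ge.
  have K1 : 1 < K by lia.
  have l1 : b (v i j) <= b (v 1 j.+1) by apply/pr_homo/lt_pr; lia.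
  have l12 : pr (v 1 j.+1) < pr (v 0 j.+2) by apply: lt_pr; lia.
  have l2 := pr_homo l12.
  have l3 : b (v 0 j.+2) <= b (v i' j') by apply/pr_homo/lt_pr; lia.
  have E : b (v 1 j.+1) = b (v 0 j.+2) by lia.
  have := hr _ _ (ltnW (pr_pl E l12)); rewrite !vr //; lia.
(* Left ends come from rows below [M] and right ends from columns above it; the interval [v M M]
   then puts all these left ends before all these right ends. [K] leaves room for [N] steps of 9 on
   each side. *)
pose N := 2 * p + 1; pose M := 9 * N + 10.
have MK : M + 9 * N + 10 < K by rewrite /M /N /K; lia.
have clique i i' j j' : i < M -> M < j' -> i' < K -> j < K -> j' < K ->
    a (v i j) <= b (v i' j').
  move=> iM Mj' i'K jK j'K; rewrite -plr.
  have l1 : pl (v i j) < pl (v M M) by apply: lt_pl; lia.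
  have l2 : pl (v M M) < pr (v M M) by rewrite plr.
  have l3 : pr (v M M) < pr (v i' j') by apply: lt_pr; lia.
  exact: ltn_trans (ltn_trans l1 l2) l3.
pose cl k := M + 1 + 9 * k.
(* With steps of 9, the rows [9 * k], [9 * k + 3], [9 * k + 6] and [9 * k + 9] are spaced as [lt_a]
   requires. *)
have /choice[x xP] : forall k, exists x, k < N ->
    a (v (9 * k + 3) 0) <= b x < a (v (9 * k + 6) 0).
  move=> k; have [kN|kN] := ltnP k N; last by exists v00.
  have [|x xP] := @left_sep (v (9 * k + 3) 0) (v (9 * k + 6) 0).
    by apply: lt_a; lia.
  by exists x.
have /choice[y yP] : forall k, exists y, k < N ->
    b (v 0 (cl k + 3)) < a y <= b (v 0 (cl k + 6)).
  move=> k; have [kN|kN] := ltnP k N; last by exists v00.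
  have [|y yP] := @right_sep (v 0 (cl k + 3)) (v 0 (cl k + 6)).
    by apply: lt_b; rewrite /cl; lia.
  by exists y.
pose w s r := v (9 * s) (cl r).
have wx s r k : s <= 2 * p -> r <= 2 * p -> k < 2 * p ->
    w s r <> x k /\ adj (w s r) (x k) = (s <= k) (+) flip t (tau (x k)).
  move=> sN rN kN; have /andP[x1 x2] := xP k ltac:(rewrite /N; lia).
  have cliq : a (v (9 * k + 6) 0) <= b (w s r) by apply: clique; rewrite /cl; lia.
  have ne : w s r <> x k by move=> E; move: cliq x2; rewrite -E; lia.
  split=> //; rewrite adjE ?vt; try (rewrite ?/cl; lia); last exact/eqP.
  congr (_ (+) _); have := ab (x k); case: (leqP s k) => sk xab.
    have : a (w s r) < a (v (9 * k + 3) 0) by apply: lt_a; rewrite ?/cl; lia.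
    by lia.
  have : a (v (9 * k + 6) 0) < a (w s r) by apply: lt_a; rewrite ?/cl; lia.
  by lia.
(* The intervals meet when [k < r]; this negation of [r <= k] is moved into the flip. *)
have wy s r k : s <= 2 * p -> r <= 2 * p -> k < 2 * p ->
    w s r <> y k /\ adj (w s r) (y k) = (r <= k) (+) ~~ flip t (tau (y k)).
  move=> sN rN kN; have /andP[y1 y2] := yP k ltac:(rewrite /N; lia).
  have cliq : a (w s r) <= b (v 0 (cl k + 3)) by apply: clique; rewrite /cl; lia.
  have ne : w s r <> y k by move=> E; move: cliq y1; rewrite -E; lia.
  split=> //; rewrite adjE ?vt; try (rewrite ?/cl; lia); last exact/eqP.
  rewrite addbN -addNb; congr (_ (+) _); have := ab (y k); case: (leqP r k) => rk yab.
    have : b (w s r) < b (v 0 (cl k + 3)) by apply: lt_b; rewrite ?/cl; lia.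
    by lia.
  have : b (v 0 (cl k + 6)) < b (w s r) by apply: lt_b; rewrite ?/cl; lia.
  by lia.
have xy k l : k < 2 * p -> l < 2 * p -> x k <> y l.
  move=> kN lN E; have /andP[_ x2] := xP k ltac:(rewrite /N; lia).
  have /andP[y1 _] := yP l ltac:(rewrite /N; lia).
  have : a (v (9 * k + 6) 0) <= b (v 0 (cl l + 3)) by apply: clique; rewrite /cl; lia.
  by have := ab (y l); rewrite E in x2; lia.
have [row [colx [rowN colxN rowP]]] := half_graph_selection p (fun k => flip t (tau (x k))).
have [row' [coly [row'N colyN row'P]]] := half_graph_selection p (fun k => ~~ flip t (tau (y k))).
(* The row follows [i] and the column its preimage under [pi], so the two chains differ by [pi]. *)
apply: (@half_graphs_expose G p pi (fun i => w (row i) (row' ((pi^-1)%g i)))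
  (fun k => x (colx k)) (fun k => y (coly k))).
- by move=> i k; have [_ ->] := wx _ _ _ (rowN i) (row'N ((pi^-1)%g i)) (colxN k).
- by move=> i k; have [_ ->] := wy _ _ _ (rowN i) (row'N ((pi^-1)%g i)) (colyN k).
- by move=> i k; have [] := wx _ _ _ (rowN i) (row'N ((pi^-1)%g i)) (colxN k).
- by move=> i k; have [] := wy _ _ _ (rowN i) (row'N ((pi^-1)%g i)) (colyN k).
- by move=> i k; apply: xy.
Qed.

End GridExposes.

Lemma isomorphic_refl (G : sgraph) : isomorphic G G.
Proof. by exists id; split=> //; exists id. Qed.

(** A grid within one type would put a graph exposing [pi] into [C] by heredity. Its forbidden size
    depends on [p] alone, hence so does [c]. *)
Lemma excludes_bounded_twin_width (R : realType) (r : nat) (C : sgraph -> Prop)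
    p (pi : 'S_p) :
  hereditary C -> (forall G : sgraph, C G -> perturbed_interval_graph R r G) ->
  excludes C (exposes pi) -> bounded_twin_width C.
Proof.
move=> hC pC exC; have [c cP] := marcus_tardos (20 * (2 * p + 2)).
exists (2 * (8 * (c * 2 ^ r) + 2) + 2 ^ r) => G CG.
have [D [tau [flip [a0 [b0 [Dr ab0 adj0]]]]]] := perturbed_interval_model (pC G CG).
pose a := tight_left a0 b0; pose b := tight_right a0 b0.
have abE u v : (a u <= b v) = (a0 u <= b0 v) by apply: tight_leq.
have [pl [pr [pl_inj pr_inj plr homo_lr mono_lr]]] := endpoint_positions a b.
have adjE u v : u != v ->
    adj u v = ((a u <= b v) && (a v <= b u)) (+) flip (tau u) (tau v).
  by move=> uv; rewrite adj0 // !abE.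
apply: leq_trans (_ : 2 * (8 * (c * #|D|) + 2) + #|D| <= _); last first.
  by move: Dr; set e := 2 ^ r; clear; nia.
apply: (@no_grid_twin_width G D tau flip pl pr _ _ _ (20 * (2 * p + 2))) => //.
- by move=> u v uv; rewrite adjE // !plr.
- move=> t grid; have ab v : a v <= b v by rewrite abE.
  have [H HG eH] := grid_exposes ab adjE (@tight_left_sep _ a0 b0)
    (@tight_right_sep _ a0 b0) plr (fun u v => (homo_lr u v).1)
    (fun u v => (homo_lr u v).2) (fun u v => (mono_lr u v).1)
    (fun u v => (mono_lr u v).2) pi grid.
  exact: (exC H H (hC G H CG HG) eH (isomorphic_refl H)).
Qed.

Theorem theorem5p3 (R : realType) (r : nat) (C : sgraph -> Prop)
    (hereditaryC : hereditary C)
    (perturbedC : forall G : sgraph, C G -> perturbed_interval_graph R r G) :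
  bounded_twin_width C <->
  exists (p : nat) (pi : 'S_p), 0 < p /\ excludes C (exposes pi).
Proof.
split=> [|[p [pi [_ exC]]]]; first exact: bounded_twin_width_excludes.
exact: excludes_bounded_twin_width perturbedC exC.
Qed.
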